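(* For every $a \in \mathbb{R}_{>0}$ and every $d \in \mathbb{Z}_{\geq 1}$ we have $$ \widetilde{\mathbf{T}}_d^a = (\Gamma^a_2!)^d\sum_{T \in \mathfrak{T}^{\mathrm{un}}_d}\frac{(-1)^{|V_{\mathrm{in}}(T) \setminus V_{\mathrm{mov}}(T)|}}{|\mathrm{Aut}(T)|} \cdot \prod_{v \in V_{\mathrm{in}}(T)}\left(\frac{\Gamma^a_{3\ell(v)-1}!}{\left(\sum_{v' \to v} \Gamma^a_{3\ell(v')-1}\right)!}\right)\cdot \prod_{v \in V_{\mathrm{mov}}(T)} \left((\ell(v)!)^{-2}\, \frac{ \left( \ell(v)\,\Gamma^a_{2} \right)!}{(\Gamma^a_2!)^{\ell(v)}}-1\right). $$ Here the sum $\sum_{v' \to v}$ is over all vertices $v'$ of $T$ which are adjacent to $v$ and lie strictly above it. Empty products are equal to $1$.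
   Context: **Lattice paths.** For irrational $a>0$ and $k \in \mathbb{Z}_{\geq 0}$, $\Gamma^a_k \in \mathbb{Z}_{\geq 0}^2$ is the (unique) pair $(i,j)$ which minimizes $\max\{i,aj\}$ among all $(i,j) \in \mathbb{Z}_{\geq 0}^2$ with $i+j=k$. For rational $a>0$ we use the convention $\Gamma^a_k := \Gamma^{a+\delta}_k$ for $\delta>0$ sufficiently small (irrational perturbation). Pairs in $\mathbb{Z}_{\geq 0}^2$ are added componentwise and multiplied by nonnegative integers componentwise, and the factorial of a pair is $(i,j)! := i!\,j!$. **The counts.** $\mathbf{T}_d^a \in \mathbb{Q}$ denotes the ellipsoidal superpotential of $\mathbb{CP}^2$ in degree $d$ with ellipsoid shape $(1,a)$, defined as follows for $a$ irrational. Let $E(a_1,a_2) = \{(z_1,z_2) \in \mathbb{C}^2 : \pi(|z_1|^2/a_1 + |z_2|^2/a_2) \leq 1\}$. Choose a symplectic embedding $\iota: E(\epsilon,\epsilon a) \hookrightarrow \mathbb{CP}^2$ for some small $\epsilon>0$, let $M_a$ be $\mathbb{CP}^2$ minus the image under $\iota$ of the interior of $E(\epsilon,\epsilon a)$, and let $\widehat{M}_a = M_a \cup (\mathbb{R}_{\leq 0} \times \partial M_a)$ be its symplectic completion, with an admissible almost complex structure $J$ in the sense of symplectic field theory. Then $\mathbf{T}_d^a$ is the (in general virtual) count of index zero finite energy $J$-holomorphic planes $u : \mathbb{C} \to \widehat{M}_a$ in homology class $d[L]$, where $[L] \in H_2(\mathbb{CP}^2)$ is the line class. For rational $a$, $\mathbf{T}_d^a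 := \mathbf{T}_d^{a+\delta}$ for $\delta>0$ sufficiently small. Set $$\widetilde{\mathbf{T}}_d^a := \mathrm{mult}_a(\Gamma^a_{3d-1})\cdot \mathbf{T}_d^a, \qquad \mathrm{mult}_a(i,j) = i \text{ if } i > aj, \quad \mathrm{mult}_a(i,j)=j \text{ otherwise.}$$ It is a known theorem (from earlier work of Mikhalkin and Siegel) that these numbers satisfy, and hence are uniquely determined by, the following recursion for all $a \in \mathbb{R}_{>0}$, $d \in \mathbb{Z}_{\geq 1}$: $$\widetilde{\mathbf{T}}_d^a = \left(\Gamma^a_{3d-1}\right)!\left( (d!)^{-3} - \sum_{\substack{k \geq 2,\ d_1,\dots,d_k \in \mathbb{Z}_{\geq 1}\\ d_1 + \cdots + d_k = d}} \frac{\widetilde{\mathbf{T}}_{d_1}^a \cdots \widetilde{\mathbf{T}}_{d_k}^a}{k!\,\left(\sum_{s=1}^k \Gamma^a_{3d_s-1} \right)!}\right).$$ **Trees.** For $k \geq 1$, $\mathfrak{T}^{\mathrm{un}}_k$ is the set of isomorphism classes of finite rooted trees with $k$ unordered leaves and no bivalent vertices. Such a tree $T$ has a distinguished root vertex (which is univalent, i.e. attached to a single ''root edge'', and is not counted as a leaf) and $k$ leaf vertices (the other univalent vertices); the remaining vertices are called internal, and the set of internal vertices is $V_{\mathrm{in}}(T)$. Thus every internal vertex has valency at least $3$. (For instance, the unique element of $\mathfrak{T}^{\mathrm{un}}_1$ is a single edge joining a leaf to the root, with no internal vertices, and the unique element of $\mathfrak{T}^{\mathrm{un}}_2$ has exactly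 one internal vertex, of valency $3$.) $\mathrm{Aut}(T)$ is the group of automorphisms of the rooted tree $T$. All edges are oriented towards the root, and a vertex $v$ is above $w$ if $w$ lies on the oriented path from $v$ to the root. An internal vertex is movable if there are no (other) internal vertices above it; $V_{\mathrm{mov}}(T) \subset V_{\mathrm{in}}(T)$ is the set of movable vertices. The leaf number $\ell(v)$ of a vertex $v$ is the number of leaf vertices lying above $v$, including possibly $v$ itself (so $\ell(v)=1$ if $v$ is a leaf). *)

(* Defs.v *)
From HB Require Import structures.
From mathcomp Require Import all_boot all_order all_algebra all_fingroup.
From mathcomp Require Import all_classical all_reals all_analysis borel_hierarchy.

Set Implicit Arguments.
Unset Strict Implicit.
Unset Printing Implicit Defensive.

Import Order.TTheory GRing.Theory Num.Theory.
Local Open Scope ring_scope.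

(* Pairs are added and multiplied by naturals in the additive monoid nat * nat. *)
Definition pfact (p : nat * nat) : nat := (p.1`! * p.2`!)%N.

Section LatticePath.
Variable R : realType.

(* For irrational [a] the minimizer is unique ([Gamma_irr_uniq]), so the choice
   made by [arg min] is irrelevant; pairs with i + j = k are listed by i. *)
Definition Gamma_irr (a : R) (k : nat) : nat * nat :=
  let i := [arg min_(i < (ord0 : 'I_k.+1)) Num.max (i%:R : R) (a * (k - i)%:R)]%O
  in (nat_of_ord i, (k - i)%N).

(* The rational case is well defined by [Gamma_rat_ex] and [Gamma_rat_uniq]. *)
Definition Gamma_rat_set (a : R) (k : nat) : set (nat * nat) :=
  [set p | exists2 e : R, 0 < e &
     forall delta : R, 0 < delta < e -> irrational (a + delta) ->
       Gamma_irr (a + delta) k = p]%classic.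

Definition Gamma (a : R) (k : nat) : nat * nat :=
  if `[< irrational a >] then Gamma_irr a k
  else xget (0%N, 0%N) (Gamma_rat_set a k).

Definition mult (a : R) (p : nat * nat) : nat :=
  if a * p.2%:R < p.1%:R then p.1 else p.2.

Definition Ttilde (T : R -> nat -> rat) (a : R) (d : nat) : rat :=
  (mult a (Gamma a (3 * d - 1)))%:R * T a d.

(* The degrees d_1, ..., d_k >= 1 with d_1 + ... + d_k = d.  Their parts are at
   most d, and there are none for k > d. *)
Definition compositions (k d : nat) : {set {ffun 'I_k -> 'I_d.+1}} :=
  [set e : {ffun 'I_k -> 'I_d.+1} |
     [forall s, (0 < e s)%N] && (\sum_s (e s : nat) == d)%N].

Definition recursion_rhs (a : R) (Tt : nat -> rat) (d : nat) : rat :=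
  (pfact (Gamma a (3 * d - 1)))%:R *
  ((d`!%:R)^-1 ^+ 3 -
   \sum_(2 <= k < d.+1) \sum_(e in compositions k d)
     (\prod_(s < k) Tt (e s)) /
     (k`!%:R * (pfact (\sum_(s < k) Gamma a (3 * e s - 1)))%:R)).

(* The counts enter only through the recursion that they are known to satisfy
   for all a > 0 and d >= 1; it has a unique solution ([superpotential_unique],
   [superpotential_exists]). *)
Definition superpotential_recursion (T : R -> nat -> rat) : Prop :=
  forall (a : R) (d : nat), 0 < a -> (1 <= d)%N ->
    Ttilde T a d = recursion_rhs a (Ttilde T a) d.

End LatticePath.

Section GammaWellDefined.
Variable R : realType.
Implicit Types (a c m e x : R) (k : nat).

Let gmax a k (i : nat) : R := Num.max (i%:R : R) (a * (k - i)%:R).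

Lemma Gamma_irrP a k (p := Gamma_irr a k) : (p.1 + p.2 = k)%N /\
  forall i j, (i + j = k)%N ->
    Num.max (p.1%:R : R) (a * p.2%:R) <= Num.max (i%:R : R) (a * j%:R).
Proof.
rewrite {}/p /Gamma_irr; case: arg_minP => //= i _ imin; split.
  by rewrite subnKC // -ltnS.
move=> i' j' k_eq; have lei' : (i' < k.+1)%N by rewrite -k_eq ltnS leq_addr.
by have := imin (Ordinal lei') isT; rewrite /= -[in (k - i')%N]k_eq addKn.
Qed.

Lemma Gamma_irr_uniq a k i j : 0 < a -> irrational a -> (i + j = k)%N ->
  (forall i' j', (i' + j' = k)%N ->
    Num.max (i%:R : R) (a * j%:R) <= Num.max (i'%:R : R) (a * j'%:R)) ->
  (i, j) = Gamma_irr a k.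
Proof.
move=> a0 aI; have [] := Gamma_irrP a k.
case: (Gamma_irr a k) => i1 j1 /= e1 min1 e min.
have : Num.max (i%:R : R) (a * j%:R) = Num.max (i1%:R : R) (a * j1%:R).
  by apply/le_anti; rewrite min // min1.
have irr (u v : nat) : (u%:R : R) = a * v%:R -> v = 0%N.
  move=> uv; apply/eqP/negPn/negP => v0; apply: aI.
  exists (u%:R / v%:R) => //=; rewrite fmorph_div /= !ratr_nat uv mulfK //.
  by rewrite pnatr_eq0.
wlog le_i : i j i1 j1 e1 e {min1 min} / (i <= i1)%N.
  move=> H; case: (leqP i i1) => [|/ltnW] le_i h; first exact: (H i j i1 j1).
  by apply/esym; apply: (H i1 j1 i j).
move=> fE; case: (ltngtP i i1) le_i => // [lt_i|ei] _; last first.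
  by congr (_, _) => //; apply/eqP; rewrite -(eqn_add2l i) e ei e1.
exfalso; have lt_j : (j1 < j)%N by rewrite -(ltn_add2l i) e -e1 ltn_add2r.
have ltRi : (i%:R : R) < i1%:R by rewrite ltr_nat.
have ltRj : a * j1%:R < a * j%:R by rewrite ltr_pM2l // ltr_nat.
move: fE; rewrite /Num.max; case: ltP => h1; case: ltP => h2 fE.
- by rewrite fE ltxx in ltRj.
- by have j0 := irr i1 j (esym fE); rewrite j0 in lt_j.
- by have := lt_le_trans ltRj h1; rewrite fE ltxx.
- by rewrite fE ltxx in ltRi.
Qed.

Definition decided_right (P : R -> bool) : Prop :=
  exists b, exists2 e : R, 0 < e & forall x, 0 < x < e -> P x = b.

Let decided_affine c m : decided_right (fun x => c + m * x <= 0).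
Proof.
case: (ltgtP c 0) => [c0|c0|->].
- exists true, (- c / (`|m| + 1)); first by rewrite divr_gt0 ?oppr_gt0 // ltr_wpDl.
  move=> x /andP[x0]; rewrite ltr_pdivlMr ?ltr_wpDl // => xm.
  rewrite -lerBrDl sub0r (le_trans _ (ltW xm)) // mulrC ler_pM2l //.
  by rewrite (le_trans (ler_norm _)) // lerDl.
- exists false, (c / (`|m| + 1)); first by rewrite divr_gt0 // ltr_wpDl.
  move=> x /andP[x0]; rewrite ltr_pdivlMr ?ltr_wpDl // => xm.
  apply/negbTE; rewrite -ltNge -[m * x]opprK subr_gt0 -mulNr (le_lt_trans _ xm) //.
  by rewrite mulrC ler_pM2l // (le_trans (ler_norm _)) // normrN lerDl.
- exists (m <= 0), 1 => // x /andP[x0 _].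
  by rewrite add0r pmulr_lle0 //.
Qed.

Let decided_or P Q : decided_right P -> decided_right Q ->
  decided_right (fun x => P x || Q x).
Proof.
move=> [b [e e0 Pe]] [c [f f0 Qf]]; exists (b || c), (Num.min e f).
  by rewrite lt_min e0.
by move=> x /andP[x0]; rewrite lt_min => /andP[xe xf]; rewrite Pe ?Qf ?x0.
Qed.

Let decided_and P Q : decided_right P -> decided_right Q ->
  decided_right (fun x => P x && Q x).
Proof.
move=> [b [e e0 Pe]] [c [f f0 Qf]]; exists (b && c), (Num.min e f).
  by rewrite lt_min e0.
by move=> x /andP[x0]; rewrite lt_min => /andP[xe xf]; rewrite Pe ?Qf ?x0.
Qed.

Let decided_le a k (i j : nat) :
  decided_right (fun x => gmax (a + x) k i <= gmax (a + x) k j).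
Proof.
have aff u v u' v' : decided_right (fun x : R => u + v * x <= u' + v' * x).
  have [b [e e0 He]] := decided_affine (u - u') (v - v').
  exists b, e => // x /He <-; rewrite -subr_le0; congr (_ <= _).
  by rewrite mulrBl opprD addrACA.
have dext P Q : P =1 Q -> decided_right P -> decided_right Q.
  by move=> PQ [b [e e0 He]]; exists b, e => // x /He <-.
apply: (dext (fun x =>
  ((i%:R <= (j%:R : R)) || (i%:R <= (a + x) * (k - j)%:R)) &&
  (((a + x) * (k - i)%:R <= (j%:R : R)) ||
   ((a + x) * (k - i)%:R <= (a + x) * (k - j)%:R)))).
  by move=> x; rewrite /gmax ge_max !le_max.
have E x n : (a + x) * n%:R = a * n%:R + n%:R * x by rewrite mulrDl [x * _]mulrC.
apply: decided_and; apply: decided_or.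
- by exists ((i%:R : R) <= j%:R), 1.
- by apply: dext (aff i%:R 0 (a * (k - j)%:R) (k - j)%:R) => x; rewrite E mul0r addr0.
- by apply: dext (aff (a * (k - i)%:R) (k - i)%:R j%:R 0) => x; rewrite E mul0r addr0.
- by apply: dext (aff (a * (k - i)%:R) (k - i)%:R (a * (k - j)%:R) (k - j)%:R)
    => x; rewrite !E.
Qed.

Lemma Gamma_rat_ex a k : exists p, Gamma_rat_set a k p.
Proof.
suff [tb [e e0 He]] : exists tb : 'I_k.+1 -> 'I_k.+1 -> bool,
    exists2 e : R, 0 < e & forall x, 0 < x < e -> forall i j : 'I_k.+1,
      (gmax (a + x) k i <= gmax (a + x) k j) = tb i j.
  pose i := odflt (ord0 : 'I_k.+1) [pick i | [forall j, tb i j]].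
  exists (i : nat, k - i)%N, e => // x xe _; rewrite /Gamma_irr.
  suff -> : [arg min_(i < (ord0 : 'I_k.+1))
      Num.max (i%:R : R) ((a + x) * (k - i)%:R)]%O = i by [].
  rewrite /Order.arg_min /extremum /i; congr odflt; apply: eq_pick => l /=.
  by apply: eq_forallb => j /=; rewrite -(He x xe).
have [b_ H] := choice (fun ij : 'I_k.+1 * 'I_k.+1 => decided_le a k ij.1 ij.2).
have {}H (ij : 'I_k.+1 * 'I_k.+1) : exists e : R, 0 < e /\ forall x, 0 < x < e ->
    (gmax (a + x) k ij.1 <= gmax (a + x) k ij.2) = b_ ij.
  by have [e e0 He] := H ij; exists e.
have {H}[e_ H] := choice H.
exists (fun i j => b_ (i, j)), (\big[Num.min/1]_ij e_ ij).
  by elim/big_ind: _ => // [u v u0 v0|ij _]; [rewrite lt_min u0 | case: (H ij)].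
move=> x /andP[x0 xe] i j; have [_ Hij] := H (i, j); apply: Hij.
by rewrite x0 (lt_le_trans xe) // bigmin_le_cond.
Qed.

Lemma irrational_right a e : 0 < e ->
  exists2 delta : R, 0 < delta < e & irrational (a + delta).
Proof.
move=> e0; have [F oF irrE] := @irrational_Gdelta R.
have := Baire oF; rewrite -irrE => dI.
have [||x [/= xae xI]] := dI `]a, a + e[%classic.
- exists (a + e / 2) => /=; rewrite in_itv /= ltrDl divr_gt0 //= ltrD2l.
  by rewrite ltr_pdivrMr // ltr_pMr // ltr1n.
- exact: interval_open.
exists (x - a); last by rewrite addrC subrK.
by move: xae; rewrite in_itv /= subr_gt0 ltrBlDl.
Qed.

Lemma Gamma_rat_uniq a k p q :
  Gamma_rat_set a k p -> Gamma_rat_set a k q -> p = q.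
Proof.
move=> [e e0 He] [f f0 Hf].
have [|x] := @irrational_right a (Num.min e f); first by rewrite lt_min e0.
rewrite lt_min => /and3P[x0 xe xf] xI.
by rewrite -(He x) ?x0 // -(Hf x) ?x0.
Qed.

Lemma Gamma_sum a k : ((Gamma a k).1 + (Gamma a k).2 = k)%N.
Proof.
rewrite /Gamma; case: ifP => _; first by have [] := Gamma_irrP a k.
case: (xgetPex (0%N, 0%N) (Gamma_rat_ex a k)) => e e0.
have [x xe xI] := @irrational_right a e e0.
by move=> /(_ x xe xI) <-; have [] := Gamma_irrP (a + x) k.
Qed.

Lemma mult_Gamma_gt0 a k :
  0 < a -> (0 < k)%N -> (0 < mult a (Gamma a k))%N.
Proof.
move=> a0 k0; rewrite /mult; have := Gamma_sum a k.
case: (Gamma a k) => i j /= e; case: ltP => h.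
  by rewrite -(ltr_nat R) (le_lt_trans _ h) // mulr_ge0 // ltW.
rewrite lt0n; apply: contraTN k0 => /eqP j0.
by move: h; rewrite -e j0 mulr0 lern0 addn0 -leqNgt leqn0.
Qed.

End GammaWellDefined.

Section Superpotential.
Variable R : realType.

Let index_gt0 d : (0 < d)%N -> (0 < 3 * d - 1)%N.
Proof. by case: d => // d _; rewrite mulnS. Qed.

Let rhs_ext (a : R) (f g : nat -> rat) (d : nat) :
  (forall m, (0 < m < d)%N -> f m = g m) ->
  recursion_rhs a f d = recursion_rhs a g d.
Proof.
move=> fg; rewrite /recursion_rhs; congr (_ * (_ - _)).
apply: eq_big_nat => k /andP[k2 _]; apply: eq_bigr => c.
rewrite inE => /andP[/forallP c0 /eqP cd]; congr (_ / _).
apply: eq_bigr => s _; apply: fg; rewrite c0 /=.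
have [s' ss'] : exists s' : 'I_k, s' != s.
  case: k k2 c c0 cd s => [//|[//|k]] _ c _ _ s.
  by exists (if s == ord0 then ord_max else ord0); case: (altP (s =P ord0)) => [->|];
    rewrite // eq_sym.
rewrite -[X in (_ < X)%N]cd (bigD1 s) //= (bigD1 s') //=.
by rewrite -[X in (X < _)%N]addn0 ltn_add2l addn_gt0 c0.
Qed.

Lemma superpotential_unique (T T' : R -> nat -> rat) :
  superpotential_recursion T -> superpotential_recursion T' ->
  forall a d, 0 < a -> (1 <= d)%N -> T a d = T' a d.
Proof.
move=> hT hT' a d a0; elim/ltn_ind: d => d IH d0.
have m0 : (mult a (Gamma a (3 * d - 1)))%:R != 0 :> rat.
  by rewrite pnatr_eq0 -lt0n mult_Gamma_gt0 // index_gt0.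
apply: (mulfI m0); rewrite -!/(Ttilde _ _ _) hT // hT' //.
apply: rhs_ext => m /andP[m0' md]; by rewrite /Ttilde IH.
Qed.

Lemma superpotential_exists :
  exists T : R -> nat -> rat, superpotential_recursion T.
Proof.
pose F (a : R) n := iter n (fun f => recursion_rhs a f) (fun=> 0).
have stable (a : R) n m : (m < n)%N -> F a n m = F a m.+1 m.
  elim/ltn_ind: m n => m IH [//|n] mn.
  rewrite /F !iterS; apply: rhs_ext => l /andP[_ lm].
  by rewrite -!/(F _ _) (IH l lm n) ?(IH l lm m) // (leq_trans lm).
exists (fun a d => F a d.+1 d / (mult a (Gamma a (3 * d - 1)))%:R) => a d a0 d0.
have E m : (0 < m)%N -> Ttilde (fun a d =>
    F a d.+1 d / (mult a (Gamma a (3 * d - 1)))%:R) a m = F a m.+1 m.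
  move=> m0; rewrite /Ttilde mulrC divfK // pnatr_eq0 -lt0n mult_Gamma_gt0 //.
  exact: index_gt0.
rewrite E // /F iterS; apply: rhs_ext => m /andP[m0 md].
by rewrite -/(F a d) stable // E.
Qed.

End Superpotential.

(* A finite rooted tree with vertex set V is given by the map sending every
   vertex to the next one on its path to the root, and the root to itself.
   Thus [fconnect p v w] says that w lies on the path from v to the root. *)
Section Trees.
Variables (V : finType) (p : {ffun V -> V}).
Implicit Types v w : V.

Definition is_root v : bool := p v == v.
Definition is_rooted_tree : bool :=
  [exists r, is_root r && [forall v, fconnect p v r]].

(* v' -> v *)
Definition children v : {set V} := [set w | (p w == v) && (w != v)].
Definition valency v : nat := (#|children v| + ~~ is_root v)%N.

Definition leaves : {set V} := [set v | ~~ is_root v & valency v == 1%N].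
Definition Vin : {set V} := [set v | ~~ is_root v & valency v != 1%N].
Definition Vmov : {set V} :=
  [set v in Vin | [forall w in Vin, fconnect p w v ==> (w == v)]].
Definition leaf_number v : nat := #|[set w in leaves | fconnect p w v]|.

Definition is_unordered_tree (k : nat) : bool :=
  [&& is_rooted_tree,
      [forall v, is_root v ==> (valency v == 1%N)],
      [forall v, valency v != 2%N]
    & #|leaves| == k].

(* The root is the only fixed point of p, so it is preserved automatically. *)
Definition Aut_tree : {set {perm V}} :=
  [set s : {perm V} | [forall v, s (p v) == p (s v)]].

End Trees.

Definition iso_tree (V : finType) (p q : {ffun V -> V}) : bool :=
  [exists s : {perm V}, [forall v, s (p v) == q (s v)]].

Lemma iso_tree_equiv (V : finType) : equivalence_rel (@iso_tree V).
Proof.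
have tr (p q r : {ffun V -> V}) : iso_tree p q -> iso_tree p r -> iso_tree q r.
  move=> /existsP[s /forallP hs] /existsP[t /forallP ht].
  apply/existsP; exists (s^-1 * t)%g; apply/forallP => v.
  rewrite !permM -(eqP (ht _)); apply/eqP; congr (t _).
  by apply: (canLR (permK s)); rewrite (eqP (hs _)) permKV.
have rf (p : {ffun V -> V}) : iso_tree p p.
  by apply/existsP; exists 1%g; apply/forallP => v; rewrite !perm1.
move=> p q r; split=> // pq; apply/idP/idP; first exact: tr.
exact: tr (tr _ _ _ pq (rf p)).
Qed.

Section TreeBound.
Variables (V : finType) (p : {ffun V -> V}) (k : nat).

Lemma card_unordered_tree : is_unordered_tree p k -> (#|V| <= 2 * k)%N.
Proof.
case/and4P=> _ /forallP r1 /forallP v2 /eqP <-.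
have cardV : (\sum_v #|[set w | p w == v]| = #|V|)%N.
  rewrite -[RHS]sum1_card [RHS](partition_big p predT) //=.
  apply: eq_bigr => v _.
  by rewrite sum1dep_card.
have children_le v : (2 <= #|[set w | p w == v]| + 2 * (v \in leaves p))%N.
  have -> : #|[set w | p w == v]| = (#|children p v| + is_root p v)%N.
    rewrite (cardsD1 v) inE addnC; congr (_ + _)%N; apply: eq_card => w.
    by rewrite !inE andbC.
  move: (r1 v) (v2 v); rewrite inE /valency.
  by case: (is_root p v); case: #|children p v| => [|[|c]].
have : (\sum_(v : V) 2 <= \sum_v (#|[set w | p w == v]| + 2 * (v \in leaves p)))%N.
  exact: leq_sum.
rewrite sum_nat_const big_split /= cardV -big_distrr /= -big_mkcond /= sum1_card.
by rewrite -[#|{: V}|]/#|V| muln2 -addnn leq_add2l.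
Qed.

End TreeBound.

(* One representative per isomorphism class of trees with k leaves and exactly n
   vertices; these have n <= 2 k, see [card_unordered_tree]. *)
Definition unordered_trees (n k : nat) : {set {ffun 'I_n -> 'I_n}} :=
  let D := [set p : {ffun 'I_n -> 'I_n} | is_unordered_tree p k] in
  transversal (equivalence_partition (@iso_tree 'I_n) D) D.

(* Main.v *)
Require Import Defs.
From mathcomp Require Import all_boot all_order all_algebra all_fingroup.
From mathcomp Require Import reals.
From mathcomp Require Import zify ring.
Import Order.TTheory GRing.Theory Num.Theory.
Set Implicit Arguments.
Unset Strict Implicit.
Unset Printing Implicit Defensive.
Local Open Scope ring_scope.

(** Put g = Gamma_2 !, G_d = Gamma_(3d-1) and S_d = Ttilde_d / g^d.  After division
    by g^d the recursion for Ttilde reads: S_1 = 1, and S_d is the sum over k >= 2 and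
    compositions e of d into k parts of kappa(e) / k! times the product of the S_(e_i),
    where kappa(e) = G_d ! / (sum of the G_(e_i))! times a factor which is -1, or,
    if all parts are 1, the factor of a movable vertex.  The inhomogeneous term
    (d!)^-3 is exactly what the movable factor adds to -1 for the only composition
    into ones ([vertex_weight_recursion], [rescaled_superpotential]).

    The sum over trees obeys the same recursion: cut off the vertex v next to the root;
    the parts e_i are the leaf numbers of the children of v, and kappa(e) is the factor
    of v.  To make this precise for isomorphism classes weighted by 1 / |Aut|,
    orbit counting replaces the sum over classes of trees on n vertices by 1 / n! times
    the sum over all parent maps on 'I_n ([sum_unordered_trees]).

    Parent maps are then counted through forests with an ordered list of roots, the
    numbers of tips over the roots being prescribed.  Deleting the first root and
    putting its k children, in any of their k! orders, at the front of the list is a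
    bijection up to the factor k! ([sum_forest_graft], [sum_delete_root]); it needs no
    splitting of the vertex set among the subtrees.  So the weighted
    number of forests on a set of m vertices is m! times a number [forest_count] given
    by a recursion on m ([forest_sumE]).  Summed over m, this number is multiplicative
    in the list of roots, with factors S_d ([forest_count_total]).  The sums are
    finite as a tree with d tips and no unary vertex has at most 2d-1
    vertices.  A planted tree is a forest with one root grafted onto one more vertex
    ([sum_planted_trees]). *)

(** * Reachability along a parent map *)
Section Reachability.
Variable V : finType.
Implicit Types (p : {ffun V -> V}) (v w u c : V) (A : {set V}) (s cs : seq V).

Definition acyclic p : bool :=
  [forall v, forall w, fconnect p v w && fconnect p w v ==> (v == w)].

Lemma acyclicP p : reflect
  (forall v w, fconnect p v w -> fconnect p w v -> v = w) (acyclic p).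
Proof.
apply: (iffP forallP) => [H v w vw wv|H v]; last first.
  by apply/forallP => w; apply/implyP => /andP[vw wv]; apply/eqP; apply: H.
by have /forallP/(_ w) := H v; rewrite vw wv => /eqP.
Qed.

Lemma fconnect_fixed p v w : p v = v -> fconnect p v w -> w = v.
Proof. by move=> pv /iter_findex <-; rewrite iter_fix. Qed.

Lemma fconnect_step p v w : fconnect p v w -> v = w \/ fconnect p (p v) w.
Proof.
move=> /iter_findex; case: (findex p v w) => [/= ->|n]; first by left.
by rewrite iterSr => <-; right; apply: fconnect_iter.
Qed.

Lemma acyclic_fixed p v : acyclic p -> exists2 w, fconnect p v w & p w = w.
Proof.
move=> /acyclicP ac; exists (iter (fingraph.order p v).-1 p v); first exact: fconnect_iter.
apply/esym/ac; first exact: fconnect1.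
have : iter (fingraph.order p v) p v \in traject p v (fingraph.order p v).
  exact: (loopingP (looping_order p v)).
rewrite -{1}[fingraph.order p v]prednK ?order_gt0 // iterS => /trajectP[i i_lt ->].
have -> : (fingraph.order p v).-1 = ((fingraph.order p v).-1 - i + i)%N.
  by rewrite subnK // -ltnS prednK ?order_gt0.
by rewrite iterD; apply: fconnect_iter.
Qed.

(** Along a path the last step into [v] comes from a single child, since two
    children of [v] on one path would close a cycle through [v]. *)
Lemma fconnect_children p v w : acyclic p ->
  fconnect p w v = ((w == v) + \sum_(u in children p v) fconnect p w u)%N :> nat.
Proof.
move=> /acyclicP ac.
have child_conn u : u \in children p v -> fconnect p u v.
  by rewrite inE => /andP[/eqP <- _]; apply: fconnect1.
have [->|wv] := eqVneq w v.
  rewrite connect0 big1 // => u uC; case: (boolP (fconnect p v u)) => // vu.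
  by move: (uC); rewrite inE (ac v u vu (child_conn u uC)) eqxx andbF.
case: (boolP (fconnect p w v)) => [cwv|ncwv]; last first.
  rewrite big1 // => u uC; case: (boolP (fconnect p w u)) => // wu.
  by rewrite (connect_trans wu (child_conn u uC)) in ncwv.
have [u uC wu] : exists2 u, u \in children p v & fconnect p w u.
  move: cwv => /iter_findex; move: (findex p w v) => n; elim: n w wv => [|n IH] w wv.
    by move=> /= wE; rewrite wE eqxx in wv.
  rewrite iterSr; have [pwv _|pwv] := eqVneq (p w) v.
    by exists w => //; rewrite inE pwv eqxx.
  move=> /(IH _ pwv)[u uC pwu]; exists u => //.
  exact: connect_trans (fconnect1 _ _) pwu.
rewrite (bigD1 u) //= wu big1 // => u' /andP[u'C u'u].
case: (boolP (fconnect p w u')) => // wu'; case/eqP: u'u.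
have conn x y : x \in children p v -> y \in children p v -> fconnect p x y -> x = y.
  move=> xC yC /fconnect_step[//|]; move: (xC); rewrite inE => /andP[/eqP -> _] vy.
  have yv := ac _ _ vy (child_conn _ yC).
  by move: yC; rewrite inE yv eqxx andbF.
move: (iter_findex wu) (iter_findex wu'); set i := findex _ _ _; set j := findex _ _ _.
case: (leqP i j) => [le_ij|/ltnW le_ij] iE jE; last first.
  by apply: conn => //; rewrite -iE -(subnK le_ij) iterD jE; apply: fconnect_iter.
by apply/esym/conn => //; rewrite -jE -(subnK le_ij) iterD iE; apply: fconnect_iter.
Qed.

Definition childless p v : bool := children p v == set0.

(** Unlike [leaf_number], this counts an isolated root as a leaf, so that a subtree
    made into a tree of its own keeps its number. *)
Definition tips p v : nat := #|[set w | childless p w && fconnect p w v]|.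

Definition child_tips p v : seq nat := [seq tips p w | w <- enum (children p v)].

Lemma tips_rec p v : acyclic p ->
  tips p v = (childless p v + \sum_(w in children p v) tips p w)%N.
Proof.
move=> ac.
have E u : tips p u = (\sum_(w | childless p w) fconnect p w u)%N.
  rewrite /tips -sum1dep_card big_mkcondr.
  by apply: eq_bigr => w _; case: ifP.
under eq_bigr do rewrite E; rewrite E exchange_big /=.
under eq_bigr => w _ do rewrite (fconnect_children v w ac).
rewrite big_split /=; congr (_ + _)%N; rewrite big_mkcond (bigD1 v) //= eqxx.
rewrite big1 ?addn0; first by case: childless.
by move=> w /negbTE ->; case: ifP.
Qed.

Lemma tips_gt0 p v : acyclic p -> (0 < tips p v)%N.
Proof.
move=> ac; have [m] := ubnP #|[set w | fconnect p w v]|; elim: m v => // m IH v.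
rewrite ltnS => le_m; rewrite tips_rec //; case: (boolP (childless p v)) => //= /set0Pn[w wC].
rewrite add0n (bigD1 w) //= ltn_addr // IH // (leq_trans _ le_m) //.
move: wC; rewrite inE => /andP[/eqP pw wv]; apply: proper_card.
apply/properP; split.
  apply/subsetP => u; rewrite !inE => uw; apply: connect_trans uw _.
  by rewrite -pw fconnect1.
exists v; rewrite !inE ?connect0 //; apply/negP => vw; case/eqP: wv.
by apply: (acyclicP _ ac) vw; rewrite -pw fconnect1.
Qed.

(** * Cutting the root of a tree out of a forest *)

(** The vertices outside [A] are isolated fixed points: a vertex is deleted by taking it
    out of [A], and the type of parent maps stays the same. *)
Definition forest p A cs : bool :=
  [&& acyclic p, uniq cs, all (mem A) cs,
      [forall v, (p v == v) == ((v \notin A) || (v \in cs))]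
    & [forall v in A, p v \in A]].

Lemma forestP p A cs : reflect
  [/\ acyclic p, uniq cs, {subset cs <= A},
      forall v, (p v == v) = (v \notin A) || (v \in cs)
    & forall v, v \in A -> p v \in A] (forest p A cs).
Proof.
apply: (iffP and5P) => -[ac un sub fx st]; split => //.
- exact/allP.
- by move=> v; have /forallP/(_ v)/eqP := fx.
- by move=> v; have /forallP/(_ v)/implyP := st; apply.
- exact/allP.
- by apply/forallP => v; rewrite fx.
- by apply/forallP => v; apply/implyP/st.
Qed.

Definition graft c s p : {ffun V -> V} :=
  [ffun v => if v \in s then c else p v].
Definition cut c p : {ffun V -> V} := [ffun v => if p v == c then v else p v].

(** A path ending at [w <> c] never enters [c], so it does not notice whether the
    vertices of [s] are roots or children of [c]. *)
Lemma fconnect_graft c s p v w : p c = c -> {in s, forall x, p x = x} ->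
  c \notin s -> w != c -> fconnect (graft c s p) v w = fconnect p v w.
Proof.
move=> pc ps cs wc; apply/idP/idP => /iter_findex.
  move: (findex _ v w) => n; elim: n v => [|n IH] v; first by move=> /= ->.
  rewrite iterSr ffunE; case: ifP => vs.
    rewrite iter_fix ?ffunE ?(negbTE cs) // => cw.
    by rewrite cw eqxx in wc.
  by move/IH; apply: connect_trans (fconnect1 _ _).
move: (findex _ v w) => n; elim: n v => [|n IH] v; first by move=> /= ->.
rewrite iterSr; case: (boolP (v \in s)) => vs; first by rewrite ps //; apply: IH.
move/IH; apply: connect_trans; apply: connect1; by rewrite /= ffunE (negbTE vs).
Qed.

Lemma acyclic_graft c s p : p c = c -> {in s, forall x, p x = x} ->
  c \notin s -> acyclic (graft c s p) = acyclic p.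
Proof.
move=> pc ps cs; have gc : graft c s p c = c by rewrite ffunE (negbTE cs).
apply/acyclicP/acyclicP => ac v w vw wv.
  have [wc|wc] := eqVneq w c.
    by move: wv; rewrite wc => /(fconnect_fixed pc).
  have [vc|vc] := eqVneq v c.
    by move: vw; rewrite vc => /(fconnect_fixed pc).
  by apply: ac; rewrite fconnect_graft.
have [wc|wc] := eqVneq w c.
  by move: wv; rewrite wc => /(fconnect_fixed gc).
have [vc|vc] := eqVneq v c.
  by move: vw; rewrite vc => /(fconnect_fixed gc).
by apply: ac; rewrite -(@fconnect_graft c s).
Qed.

Lemma children_graft c s p v : p c = c -> {in s, forall x, p x = x} ->
  c \notin s -> v != c -> children (graft c s p) v = children p v.
Proof.
move=> pc ps cs vc; apply/setP => w; rewrite !inE ffunE; case: ifP => // ws.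
rewrite (ps w ws) eq_sym (negbTE vc) /=.
by case: eqVneq.
Qed.

Lemma children_graft_root c s p : p c = c -> 
  c \notin s -> (forall v, p v = c -> v = c) -> children (graft c s p) c = [set x in s].
Proof.
move=> pc cs inj; apply/setP => w; rewrite !inE ffunE; case: ifP => ws.
  by rewrite eqxx /=; apply: contraTneq ws => ->.
by case: eqP => // /inj ->; rewrite eqxx.
Qed.

Lemma tips_graft c s p v : p c = c -> {in s, forall x, p x = x} ->
  c \notin s -> (forall w, p w = c -> w = c) -> v != c ->
  tips (graft c s p) v = tips p v.
Proof.
move=> pc ps cs inj vc; apply: eq_card => w; rewrite !inE fconnect_graft //.
have [->|wc] := eqVneq w c; last by rewrite /childless children_graft.
suff -> : fconnect p c v = false by rewrite !andbF.
by apply/negP => /(fconnect_fixed pc) vE; rewrite vE eqxx in vc.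
Qed.

Lemma child_tips_graft c s p v : p c = c -> {in s, forall x, p x = x} ->
  c \notin s -> (forall w, p w = c -> w = c) -> v != c ->
  child_tips (graft c s p) v = child_tips p v.
Proof.
move=> pc ps cs inj vc; rewrite /child_tips children_graft //.
apply/eq_in_map => w; rewrite mem_enum inE => /andP[/eqP pw wv].
by apply: tips_graft => //; apply: contra_neq vc => wc; rewrite -pw wc pc.
Qed.

Lemma forest_graft_hyps p A c s cs : forest p (A :\ c) (s ++ cs) ->
  [/\ p c = c, {in s, forall x, p x = x}, c \notin s & forall w, p w = c -> w = c].
Proof.
move=> /forestP[_ _ sub fx st]; split.
- by apply/eqP; rewrite fx !inE eqxx.
- by move=> x xs; apply/eqP; rewrite fx mem_cat xs orbT.
- by apply/negP => ins; have /sub : c \in s ++ cs; rewrite ?mem_cat ?ins // !inE eqxx.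
- move=> w pw; case: (boolP (w \in A :\ c)) => wA.
    by have := st w wA; rewrite pw !inE eqxx.
  by move: (fx w); rewrite wA pw => /eqP.
Qed.

Lemma forest_graft p A c s cs : c \in A -> forest p (A :\ c) (s ++ cs) ->
  forest (graft c s p) A (c :: cs).
Proof.
move=> cA fp; have [pc ps cs' inj] := forest_graft_hyps fp.
move/forestP: fp => [ac un sub fx st].
move: un; rewrite cat_uniq => /and3P[us /hasPn dis ucs].
apply/forestP; split.
- by rewrite acyclic_graft.
- rewrite /= ucs andbT; apply/negP => ccs.
  by have /sub : c \in s ++ cs; rewrite ?mem_cat ?ccs ?orbT // !inE eqxx.
- move=> x; rewrite inE => /predU1P[-> //|xcs].
  by have /sub : x \in s ++ cs; rewrite ?mem_cat ?xcs ?orbT // !inE => /andP[].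
- move=> v; rewrite ffunE inE; case: ifP => vs.
    have /sub : v \in s ++ cs by rewrite mem_cat vs.
    rewrite !inE => /andP[vc vA]; rewrite eq_sym (negbTE vc) vA /=.
    by apply/esym/negP => /dis; rewrite /= vs.
  rewrite fx mem_cat vs !inE /=.
  by case: (v == c); case: (v \in A).
- move=> v vA; rewrite ffunE; case: ifP => // vs.
  have [->|vc] := eqVneq v c; first by rewrite pc.
  by have := st v; rewrite !inE vc vA => /(_ isT)/andP[].
Qed.

Lemma forest_cut p A c s cs : forest p A (c :: cs) -> uniq s ->
  children p c = [set x in s] -> graft c s (cut c p) = p /\ forest (cut c p) (A :\ c) (s ++ cs).
Proof.
move=> /forestP[ac /= /andP[ccs ucs] sub fx st] us ch.
have pc : p c = c by apply/eqP; rewrite fx inE eqxx orbT.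
have cA : c \in A by apply: sub; rewrite inE eqxx.
have chE v : (v \in s) = (p v == c) && (v != c) by move/setP/(_ v): ch; rewrite !inE => ->.
have cE : cut c p c = c by rewrite ffunE pc eqxx.
have sE : {in s, forall x, cut c p x = x}.
  by move=> x; rewrite chE ffunE => /andP[-> _].
have cs' : c \notin s by rewrite chE eqxx andbF.
have gE : graft c s (cut c p) = p.
  apply/ffunP => v; rewrite !ffunE chE; case: eqP => [pv|//] /=.
  by rewrite pv; case: eqP.
split=> //; apply/forestP; split.
- by rewrite -(acyclic_graft cE sE cs') gE.
- rewrite cat_uniq us ucs /= andbT; apply/hasPn => v vcs /=; rewrite chE.
  have /eqP -> : p v == v by rewrite fx inE vcs !orbT.
  by rewrite andbN.
- move=> v; rewrite mem_cat => /orP[|vcs].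
    rewrite chE !inE => /andP[/eqP pv vc]; rewrite vc /=.
    by apply: contraNT vc => vA; rewrite -pv eq_sym fx vA.
  rewrite !inE sub ?inE ?vcs ?orbT // andbT.
  by apply: contraNneq ccs => <-.
- move=> v; rewrite ffunE !inE mem_cat chE.
  have [->|vc] := eqVneq v c; first by rewrite pc !eqxx.
  case: (eqVneq (p v) c) => [pv|pv]; first by rewrite eqxx orbT.
  by rewrite fx inE (negbTE vc).
- move=> v; rewrite ffunE !inE => /andP[vc vA].
  by case: (eqVneq (p v) c) => pv; rewrite ?vc ?vA // pv /= st.
Qed.

(** Turning the roots [s] into the children of [c] is a bijection between forests, with
    inverse [cut c]; the order of [s] has to be given, as [c] forgets it. *)
Lemma sum_forest_graft (S : zmodType) A c s cs (F : {ffun V -> V} -> S) :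
  c \in A ->
  \sum_(p | [&& forest p A (c :: cs), uniq s & children p c == [set x in s]]) F p =
  \sum_(p | forest p (A :\ c) (s ++ cs)) F (graft c s p).
Proof.
move=> cA; rewrite (reindex_onto (graft c s) (cut c)) /=; last first.
  by move=> p /and3P[fp us /eqP ch]; have [] := forest_cut fp us ch.
apply: eq_bigl => p; apply/andP/idP => [[/and3P[fp us /eqP ch] /eqP E]|fp].
  by rewrite -E; have [] := forest_cut fp us ch.
have [pc ps cs' inj] := forest_graft_hyps fp.
split; first apply/and3P; first split.
- exact: forest_graft.
- by move/forestP: fp => [_]; rewrite cat_uniq => /and3P[].
- by rewrite children_graft_root.
- apply/eqP/ffunP => v; rewrite !ffunE; case: (boolP (v \in s)) => vs.
    by rewrite eqxx ps.
  by case: eqP => // /inj ->; rewrite pc.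
Qed.

Lemma forest_no_root p A : forest p A [::] = (A == set0) && (p == [ffun v => v]).
Proof.
apply/idP/andP => [|[/eqP -> /eqP ->]].
  move=> /forestP[ac _ _ fx st].
  have A0 : A = set0.
    apply/eqP/set0Pn => -[v vA]; have [w vw pw] := acyclic_fixed v ac.
    have wA : w \in A by rewrite -(iter_findex vw); elim: (findex p v w) => //= n /st.
    by move: (fx w); rewrite pw eqxx wA.
  rewrite A0 eqxx; split=> //; apply/eqP/ffunP => v; rewrite ffunE.
  by apply/eqP; rewrite fx A0 inE.
apply/forestP; split=> // [|v|v]; last by rewrite inE.
  apply/acyclicP => v w /fconnect_fixed; rewrite ffunE.
  by move=> /(_ erefl).
by rewrite ffunE eqxx inE.
Qed.

End Reachability.

(** * Sums over tuples and compositions *)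
Section TupleSums.
Variables (S : nmodType) (V : finType).
Implicit Types (F : seq V -> S) (n m : nat).

Lemma sum_tuple0 F : \sum_(t : 0.-tuple V) F t = F [::].
Proof.
by rewrite (big_pred1 [tuple]) // => t; apply/esym/eqP; apply: tuple0.
Qed.

Lemma sum_tupleS n F :
  \sum_(t : n.+1.-tuple V) F t = \sum_c \sum_(t : n.-tuple V) F (c :: t).
Proof.
rewrite pair_big /= (reindex (fun ct : V * n.-tuple V => [tuple of ct.1 :: ct.2])) //=.
exists (fun t => (thead t, [tuple of behead t])) => [[c t] _|t _] /=.
  by rewrite theadE; congr (_, _); apply: val_inj.
by rewrite [t in RHS]tuple_eta.
Qed.

Lemma sum_tuple_cat m n F :
  \sum_(t : (m + n).-tuple V) F t =
  \sum_(s : m.-tuple V) \sum_(t : n.-tuple V) F (s ++ t).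
Proof.
elim: m F => [|m IH] F.
  by rewrite (sum_tuple0 (fun s => \sum_(t : n.-tuple V) F (s ++ t))).
rewrite (sum_tupleS _ F) (sum_tupleS _ (fun s => \sum_(t : n.-tuple V) F (s ++ t))).
by apply: eq_bigr => c _; rewrite (IH (fun s => F (c :: s))).
Qed.
End TupleSums.

Section Enumerations.
Variable V : finType.

Lemma card_enumerations (C : {set V}) k :
  (\sum_(s : k.-tuple V) (uniq s && ([set x in s] == C)) = (k == #|C|) * k`!)%N.
Proof.
elim: k C => [|k IH] C.
  rewrite (sum_tuple0 (fun s : seq V => (uniq s && ([set x in s] == C) : nat))) /=.
  have -> : [set x in [::]] = set0 :> {set V} by apply/setP => x; rewrite !inE.
  by rewrite fact0 muln1 eq_sym -cards_eq0 [_ == 0%N]eq_sym.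
rewrite (sum_tupleS _ (fun s : seq V => (uniq s && ([set x in s] == C) : nat))).
have E c (t : k.-tuple V) : uniq (c :: t) && ([set x in c :: t] == C) =
    (c \in C) && (uniq t && ([set x in t] == C :\ c)).
  rewrite /= -andbA; case: (boolP (uniq t)) => ut; rewrite ?andbF //=.
  apply/andP/andP => -[].
    move=> ct /eqP <-; rewrite !inE eqxx; split=> //.
    apply/eqP/setP => x; rewrite !inE; have [->|//] := eqVneq x c.
    by rewrite (negbTE ct).
  move=> cC /eqP tE; have tE' x : (x \in tval t) = (x != c) && (x \in C).
    by move/setP/(_ x): tE; rewrite !inE.
  rewrite tE' eqxx; split=> //; apply/eqP/setP => x; rewrite !inE tE'.
  by have [->|] := eqVneq x c.
transitivity (\sum_c \sum_(t : k.-tuple V)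
    (c \in C) * (uniq t && ([set x in t] == C :\ c)))%N.
  by apply: eq_bigr => c _; apply: eq_bigr => t _; rewrite E -mulnb.
under eq_bigr => c _ do rewrite -big_distrr /= IH.
have D c : ((c \in C) * ((k == #|C :\ c|) * k`!) = (c \in C) * ((k.+1 == #|C|) * k`!))%N.
  by case: (boolP (c \in C)) => // cC; rewrite (cardsD1 c C) cC.
under eq_bigr => c _ do rewrite D.
rewrite -big_distrl /= -big_mkcond /= sum1_card.
by case: eqP => [<-|]; rewrite ?mul1n ?mul0n ?muln0 // factS.
Qed.

End Enumerations.

Definition parts k d (e : {ffun 'I_k -> 'I_d.+1}) : seq nat :=
  [seq nat_of_ord (e i) | i <- enum 'I_k].

Lemma size_parts k d (e : {ffun 'I_k -> 'I_d.+1}) : size (parts e) = k.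
Proof. by rewrite size_map size_enum_ord. Qed.

Lemma parts_composition k d (e : {ffun 'I_k -> 'I_d.+1}) : e \in compositions k d ->
  all (ltn 0) (parts e) /\ sumn (parts e) = d.
Proof.
rewrite inE => /andP[/forallP e0 /eqP ed]; split.
  by apply/allP => _ /mapP[i _ ->]; apply: e0.
by rewrite sumnE big_map big_enum.
Qed.

Lemma big_parts (S : Type) (idx : S) (op : Monoid.com_law idx) k d
    (e : {ffun 'I_k -> 'I_d.+1}) (F : nat -> S) :
  \big[op/idx]_(i < k) F (e i) = \big[op/idx]_(m <- parts e) F m.
Proof. by rewrite [RHS]big_map big_enum. Qed.

Lemma sum_compositions k d (s : seq nat) : size s = k -> all (ltn 0) s ->
  (\sum_(e in compositions k d) (s == parts e) = (sumn s == d))%N.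
Proof.
move=> sk s0.
have sumE (e : {ffun 'I_k -> 'I_d.+1}) : s = parts e ->
    (\sum_i e i = sumn s)%N.
  by move=> ->; rewrite sumnE big_map big_enum.
have [sd|sd] := eqVneq (sumn s) d; last first.
  rewrite big1 // => e; rewrite inE => /andP[_ /eqP ed]; case: eqP => // sE.
  by rewrite -(sumE e sE) ed eqxx in sd.
have le_d i : (nth 0%N s i < d.+1)%N.
  case: (ltnP i (size s)) => i_s; last by rewrite nth_default.
  by rewrite ltnS -sd sumnE (big_nth 0%N) big_mkord (bigD1 (Ordinal i_s)) //= leq_addr.
pose e := [ffun i : 'I_k => Ordinal (le_d i)].
have eE : s = parts e.
  apply: (@eq_from_nth _ 0%N); first by rewrite size_map size_enum_ord.
  move=> i; rewrite sk => ik; rewrite (nth_map (Ordinal ik)) ?size_enum_ord //.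
  by rewrite ffunE /= nth_enum_ord.
have eC : e \in compositions k d.
  rewrite inE (sumE e eE) sd eqxx andbT; apply/forallP => i; rewrite ffunE /=.
  by apply: (allP s0); rewrite mem_nth // sk.
rewrite (bigD1 e) //= -eE eqxx big1 // => f /andP[_ fe].
case: eqP => // fE; case/eqP: fe; apply/ffunP => i; apply: val_inj.
have : nth 0%N s i = f i.
  by rewrite fE (nth_map i) ?size_enum_ord // nth_ord_enum.
by rewrite {1}eE (nth_map i) ?size_enum_ord // nth_ord_enum.
Qed.

(** * The weighted count of forests *)
Section ForestSums.
Variable kappa : seq nat -> rat.
Hypothesis kappa_perm : forall s t, perm_eq s t -> kappa s = kappa t.
Hypothesis kappa0 : kappa [::] = 1.
Hypothesis kappa1 : forall m, kappa [:: m] = 0.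

(** The weighted number of forests with [m] vertices and [ds] tips over the
    ordered roots, divided by [m!] ([forest_sumE]); the last clause deletes the first
    root, its children then becoming the first roots. *)
Fixpoint forest_count (m : nat) (ds : seq nat) : rat :=
  match ds, m with
  | [::], _ => (m == 0%N)%:R
  | _ :: _, 0 => 0
  | d :: ds', m'.+1 => (d == 1%N)%:R * forest_count m' ds' +
      \sum_(2 <= k < d.+1) \sum_(e in compositions k d)
        kappa (parts e) / k`!%:R * forest_count m' (parts e ++ ds')
  end.

Section OnVertices.
Variable V : finType.
Implicit Types (p : {ffun V -> V}) (c : V) (A : {set V}).

Definition forest_weight p A : rat := \prod_(v in A) kappa (child_tips p v).

(** [n] is the size of [ds]; as an argument of its own it keeps casts between tuple
    types away. *)
Definition forest_sum (n : nat) A (ds : seq nat) : rat :=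
  \sum_(cs : n.-tuple V)
    \sum_(p | forest p A cs && ([seq tips p c | c <- cs] == ds)) forest_weight p A.

Lemma forest_weight_graft p A c (s cs : seq V) : c \in A ->
  forest p (A :\ c) (s ++ cs) ->
  forest_weight (graft c s p) A =
  kappa [seq tips p w | w <- s] * forest_weight p (A :\ c).
Proof.
move=> cA fp; have [pc ps cs' inj] := forest_graft_hyps fp.
rewrite /forest_weight (big_setD1 c) //=; congr (_ * _); last first.
  apply: eq_bigr => v; rewrite !inE => /andP[vc _].
  by rewrite child_tips_graft.
apply: kappa_perm; rewrite /child_tips children_graft_root //.
have -> : [seq tips (graft c s p) w | w <- enum [set x in s]] =
          [seq tips p w | w <- enum [set x in s]].
  apply/eq_in_map => w; rewrite mem_enum inE => ws; apply: tips_graft => //.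
  by apply: contraNneq cs' => <-.
apply: perm_map; apply: uniq_perm; first exact: enum_uniq.
  by move/forestP: fp => [_]; rewrite cat_uniq => /and3P[].
by move=> w; rewrite mem_enum inE.
Qed.

(** This resolves the unit by the number [k] of children of [c], their numbers of
    tips [e] and their order [s]: the [k!] orders share the weight 1, and [e] is
    determined by [s], as every child carries a tip. *)
Lemma root_resolution p c d : acyclic p -> tips p c = d ->
  1 = (childless p c)%:R + \sum_(1 <= k < d.+1) \sum_(e in compositions k d)
        (\sum_(s : k.-tuple V) ([&& uniq s, children p c == [set x in s]
           & [seq tips p w | w <- s] == parts e])%:R) / k`!%:R :> rat.
Proof.
move=> ac dE; have := tips_rec c ac; rewrite dE => d_eq.
have sumE (k : nat) (s : k.-tuple V) : (0 < k)%N ->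
    (\sum_(e in compositions k d) ([&& uniq s, children p c == [set x in s]
           & [seq tips p w | w <- s] == parts e] : nat) =
     (uniq s && ([set x in s] == children p c)))%N.
  move=> k0; rewrite [_ == children p c]eq_sym.
  case: (boolP (uniq s)) => us; last by rewrite big1.
  case: eqP => ch; last by rewrite big1.
  rewrite (@sum_compositions k d) ?size_map ?size_tuple //=; last first.
    by apply/allP => _ /mapP[w _ ->]; apply: tips_gt0.
  rewrite sumnE big_map d_eq /childless; case: (boolP (children p c == set0)) => [/eqP ch0|_].
    have : tnth s (Ordinal k0) \in children p c.
      by rewrite ch inE mem_tnth.
    by rewrite ch0 inE.
  have -> : (\sum_(w in children p c) tips p w = \sum_(w <- s) tips p w)%N.
    by rewrite ch [RHS]big_uniq //; apply: eq_bigl => x; rewrite inE.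
  by rewrite add0n !eqxx.
have E k : (1 <= k)%N -> \sum_(e in compositions k d)
        (\sum_(s : k.-tuple V) ([&& uniq s, children p c == [set x in s]
           & [seq tips p w | w <- s] == parts e])%:R) / k`!%:R =
        (k == #|children p c|)%:R :> rat.
  move=> k0; rewrite -mulr_suml exchange_big /=.
  under eq_bigr => s _ do rewrite -natr_sum sumE //.
  rewrite -natr_sum card_enumerations natrM mulfK //.
  by rewrite pnatr_eq0 -lt0n fact_gt0.
rewrite (eq_big_nat _ _ (F2 := fun k => (k == #|children p c|)%:R)); last first.
  by move=> k /andP[k0 _]; apply: E.
rewrite /childless -cards_eq0; have [C0|C0] := eqVneq #|children p c| 0%N.
  by rewrite C0 big_nat big1 ?addr0 // => k /andP[k0 _]; rewrite eqn0Ngt k0.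
rewrite add0r (bigD1_seq #|children p c|) ?iota_uniq //=; last first.
  rewrite mem_index_iota lt0n C0 ltnS d_eq /childless -cards_eq0 (negbTE C0) add0n.
  by rewrite -sum1_card; apply: leq_sum => w _; apply: tips_gt0.
by rewrite eqxx big1 ?addr0 // => k /negbTE ->.
Qed.

Lemma tips_graft_forest p A c (s cs : seq V) : c \in A ->
  forest p (A :\ c) (s ++ cs) ->
  [seq tips (graft c s p) w | w <- s ++ cs] = [seq tips p w | w <- s ++ cs] /\
  tips (graft c s p) c = ((s == [::]) + sumn [seq tips p w | w <- s])%N.
Proof.
move=> cA fp; have [pc ps cs' inj] := forest_graft_hyps fp.
have ccs : c \notin s ++ cs.
  apply/negP => ins; have /forestP[_ _ sub _ _] := fp.
  by have := sub c ins; rewrite !inE eqxx.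
have E w : w \in s ++ cs -> tips (graft c s p) w = tips p w.
  by move=> ws; apply: tips_graft => //; apply: contraNneq ccs => <-.
split; first exact/eq_in_map.
have /forestP[ac _ _ _ _] := forest_graft cA fp.
have us : uniq s by move/forestP: fp => [_]; rewrite cat_uniq => /and3P[].
rewrite tips_rec // /childless children_graft_root //; congr (_ + _)%N.
  congr nat_of_bool; case: (s) => [|x s']; first by apply/eqP/setP => x; rewrite !inE.
  by apply/negbTE/set0Pn; exists x; rewrite !inE eqxx.
rewrite sumnE big_map [RHS]big_uniq //; apply: eq_big => w; rewrite inE // => ws.
by apply: E; rewrite mem_cat ws.
Qed.

(** With an ordered list [s] of the children of [c] given, [p] is a graft; this
    determines [tips p c] and splits off the factor of [c] from the weight. *)
Lemma sum_cut_root A c (cs s : seq V) d (ds t : seq nat) : c \in A -> size s = size t ->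
  \sum_(p | forest p A (c :: cs) && ([seq tips p x | x <- c :: cs] == d :: ds))
     forest_weight p A * ([&& uniq s, children p c == [set x in s]
           & [seq tips p w | w <- s] == t])%:R =
  (((s == [::]) + sumn t)%N == d)%:R * kappa t *
    \sum_(p | forest p (A :\ c) (s ++ cs) &&
             ([seq tips p x | x <- s ++ cs] == t ++ ds)) forest_weight p (A :\ c).
Proof.
move=> cA st.
transitivity (\sum_(p | [&& forest p A (c :: cs), uniq s & children p c == [set x in s]])
    forest_weight p A * (([seq tips p w | w <- s] == t) &&
      ([seq tips p x | x <- c :: cs] == d :: ds))%:R).
  rewrite big_mkcondr [RHS]big_mkcondr /=; apply: eq_bigr => p fp.
  case: (uniq s); case: (children p c == _); rewrite /= ?mulr0 ?if_same //.
  by case: (_ == d :: ds); rewrite ?andbF ?andbT ?mulr0.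
rewrite sum_forest_graft // [in RHS]big_mkcondr [in RHS]mulr_sumr; apply: eq_bigr => p fp.
have [] := tips_graft_forest cA fp; rewrite !map_cat => /eqP.
rewrite eqseq_cat ?size_map // => /andP[/eqP -> /eqP csE] cE.
rewrite /= cE csE eqseq_cat ?size_map // eqseq_cons.
rewrite (forest_weight_graft cA fp).
case: eqP => [->|_] /=; last by rewrite !mulr0.
by case: (_ == d); case: (_ == ds); rewrite /= ?mulr0 ?mul0r ?mul1r ?mulr1.
Qed.

Lemma sum_delete_root A c (cs : seq V) d (ds : seq nat) : c \in A ->
  \sum_(p | forest p A (c :: cs) && ([seq tips p x | x <- c :: cs] == d :: ds))
     forest_weight p A =
  (d == 1%N)%:R * \sum_(p | forest p (A :\ c) cs && ([seq tips p x | x <- cs] == ds))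
     forest_weight p (A :\ c) +
  \sum_(2 <= k < d.+1) \sum_(e in compositions k d) kappa (parts e) / k`!%:R *
    \sum_(s : k.-tuple V) \sum_(p | forest p (A :\ c) (s ++ cs) &&
       ([seq tips p x | x <- s ++ cs] == parts e ++ ds)) forest_weight p (A :\ c).
Proof.
move=> cA.
pose P p := forest p A (c :: cs) && ([seq tips p x | x <- c :: cs] == d :: ds).
have split_p p : P p -> forest_weight p A = forest_weight p A * (childless p c)%:R +
    \sum_(1 <= k < d.+1) \sum_(e in compositions k d) \sum_(s : k.-tuple V)
      forest_weight p A * ([&& uniq s, children p c == [set x in s]
           & [seq tips p w | w <- s] == parts e])%:R / k`!%:R.
  move=> /andP[/forestP[ac _ _ _ _]] /=; rewrite eqseq_cons => /andP[/eqP cd _].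
  have := congr1 ( *%R (forest_weight p A)) (root_resolution ac cd).
  rewrite mulr1 => {1}->; rewrite mulrDr mulr_sumr.
  congr (_ + _); apply: eq_bigr => k _; rewrite mulr_sumr; apply: eq_bigr => e _.
  by rewrite mulrA mulr_sumr mulr_suml.
rewrite (eq_bigr _ split_p) big_split /=; congr (_ + _).
  have := @sum_cut_root A c cs [::] d ds [::] cA erefl.
  rewrite /= addn0 kappa0 mulr1 [1%N == d]eq_sym => <-; apply: eq_bigr => p _.
  have -> : [set x in [::]] = set0 :> {set V} by apply/setP => x; rewrite !inE.
  by rewrite eqxx andbT.
rewrite exchange_big /=.
have cutE k (e : {ffun 'I_k -> 'I_d.+1}) : (0 < k)%N -> e \in compositions k d ->
    \sum_(p | P p) \sum_(s : k.-tuple V)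
      forest_weight p A * ([&& uniq s, children p c == [set x in s]
           & [seq tips p w | w <- s] == parts e])%:R / k`!%:R =
    kappa (parts e) / k`!%:R *
    \sum_(s : k.-tuple V) \sum_(p | forest p (A :\ c) (s ++ cs) &&
       ([seq tips p x | x <- s ++ cs] == parts e ++ ds)) forest_weight p (A :\ c).
  move=> k0 /parts_composition[_ sumE]; rewrite exchange_big mulr_sumr.
  apply: eq_bigr => s _; rewrite -mulr_suml.
  rewrite (@sum_cut_root A c cs s d ds (parts e)) ?size_parts ?size_tuple //.
  have -> : (tval s == [::]) = false.
    by apply/negbTE; rewrite -size_eq0 size_tuple -lt0n.
  by rewrite add0n sumE eqxx mul1r mulrAC.
transitivity (\sum_(1 <= k < d.+1) \sum_(e in compositions k d) kappa (parts e) / k`!%:R *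
    \sum_(s : k.-tuple V) \sum_(p | forest p (A :\ c) (s ++ cs) &&
       ([seq tips p x | x <- s ++ cs] == parts e ++ ds)) forest_weight p (A :\ c)).
  apply: eq_big_nat => k /andP[k0 _]; rewrite exchange_big /=.
  by apply: eq_bigr => e eC; apply: cutE.
case: (d) => [|d']; first by rewrite !big_geq.
rewrite [LHS]big_ltn // [X in X + _]big1 ?add0r // => e _.
have [x ->] : exists x, parts e = [:: x].
  by case: (parts e) (size_parts e) => [|x []] // _; exists x.
by rewrite kappa1 !mul0r.
Qed.

Lemma forest_sum_cons n A d ds : forest_sum n.+1 A (d :: ds) =
  \sum_(c in A) ((d == 1%N)%:R * forest_sum n (A :\ c) ds +
    \sum_(2 <= k < d.+1) \sum_(e in compositions k d)
      kappa (parts e) / k`!%:R * forest_sum (k + n) (A :\ c) (parts e ++ ds)).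
Proof.
rewrite /forest_sum (sum_tupleS _ (fun cs : seq V =>
  \sum_(p | forest p A cs && ([seq tips p c | c <- cs] == d :: ds)) forest_weight p A)).
rewrite [RHS]big_mkcond /=; apply: eq_bigr => c _; case: ifPn => cA; last first.
  rewrite big1 // => cs _; rewrite big_pred0 // => p.
  case: forestP => //= -[_ _ sub _ _]; rewrite sub // inE ?eqxx // in cA.
under eq_bigr => cs _ do rewrite sum_delete_root //.
rewrite big_split -mulr_sumr /=; congr (_ + _); rewrite exchange_big.
apply: eq_bigr => k _; rewrite exchange_big; apply: eq_bigr => e _.
rewrite -mulr_sumr; congr (_ * _); rewrite exchange_big /=.
by rewrite (sum_tuple_cat k n (fun cs : seq V =>
  \sum_(p | forest p (A :\ c) cs && ([seq tips p c | c <- cs] == parts e ++ ds))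
    forest_weight p (A :\ c))).
Qed.

Lemma forest_sum_nil A : forest_sum 0 A [::] = (A == set0)%:R.
Proof.
rewrite /forest_sum (sum_tuple0 (fun cs : seq V =>
  \sum_(p | forest p A cs && ([seq tips p c | c <- cs] == [::])) forest_weight p A)) /=.
under eq_bigl => p do rewrite forest_no_root andbT.
have [->|A0] := eqVneq A set0; last by rewrite big_pred0.
by rewrite big_pred1_eq /forest_weight big_set0.
Qed.

(** By induction on the number of vertices: the first root can be any vertex of [A],
    and this turns the factorial of [#|A|.-1] into that of [#|A|]. *)
Lemma forest_sumE A ds :
  forest_sum (size ds) A ds = #|A|`!%:R * forest_count #|A| ds.
Proof.
have [m] := ubnPeq #|A|; elim: m A ds => [|m IH] A [|d ds] /eqP Am.
- by rewrite forest_sum_nil -cards_eq0 Am mulr1.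
- by move/eqP: Am; rewrite cards_eq0 => /eqP ->; rewrite forest_sum_cons big_set0 mulr0.
- by rewrite forest_sum_nil -cards_eq0 Am mulr0.
rewrite forest_sum_cons (eq_bigr (fun=> m`!%:R * forest_count m.+1 (d :: ds))).
  by rewrite sumr_const Am -[_ *+ _]mulr_natl mulrA -natrM -factS.
move=> c cA; have cm : #|A :\ c| == m by rewrite -eqSS -Am (cardsD1 c A) cA.
rewrite (IH _ ds cm) /= mulrDr mulrCA; congr (_ + _).
rewrite mulr_sumr; apply: eq_bigr => k _; rewrite mulr_sumr; apply: eq_bigr => e _.
have sE : (k + size ds)%N = size (parts e ++ ds) by rewrite size_cat size_parts.
by rewrite -/(size ds) [(k + _)%N]sE IH // mulrCA.
Qed.

End OnVertices.

(** A tree planted at an extra root vertex [r] is a one-rooted forest on the other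
    vertices, grafted onto [r]. *)
Lemma sum_planted_trees (V : finType) d :
  \sum_(r : V) \sum_(p | [&& forest p [set: V] [:: r], #|children p r| == 1%N
     & tips p r == d]) forest_weight p ([set: V] :\ r) =
  \sum_(r : V) #|V|.-1`!%:R * forest_count #|V|.-1 [:: d].
Proof.
apply: eq_bigr => r _; set A := [set: V] :\ r.
have rT : r \in [set: V] by rewrite inE.
have cardA : #|A| = #|V|.-1 by rewrite -cardsT (cardsD1 r [set: V]) rT.
rewrite -cardA -(forest_sumE A [:: d]) /forest_sum /=.
rewrite (sum_tupleS _ (fun cs : seq V =>
  \sum_(p | forest p A cs && ([seq tips p c | c <- cs] == [:: d])) forest_weight p A)).
transitivity (\sum_(t : V) \sum_(p | [&& forest p [set: V] [:: r], uniq [:: t]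
    & children p r == [set x in [:: t]]]) (tips p r == d)%:R * forest_weight p A).
  rewrite (exchange_big_dep (fun p => forest p [set: V] [:: r])) /=; last by move=> t p _ /andP[].
  rewrite big_mkcondr; apply: eq_bigr => p fp; rewrite fp /=.
  case: ifP => [/andP[/cards1P[t tE] ->]|].
    rewrite (big_pred1 t) ?mul1r // => t'; rewrite tE.
    apply/eqP/eqP => [/setP/(_ t)|->]; first by rewrite !inE eqxx => /esym/eqP.
    by apply/setP => x; rewrite !inE.
  case: (tips p r == d); rewrite ?andbT => C; last by rewrite big1 // => t _; rewrite mul0r.
  rewrite big_pred0 // => t; apply: contraFF C => /eqP ->.
  by apply/cards1P; exists t; apply/setP => x; rewrite !inE.
apply: eq_bigr => t _; rewrite (sum_tuple0 (fun cs : seq V =>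
  \sum_(p | forest p A (t :: cs) && ([seq tips p c | c <- t :: cs] == [:: d]))
     forest_weight p A)) sum_forest_graft // [RHS]big_mkcondr; apply: eq_bigr => p fp.
have [_ ->] := tips_graft_forest rT fp; have [pr ps rs inj] := forest_graft_hyps fp.
rewrite /= add0n addn0 eqseq_cons andbT.
case: ifP => _; rewrite ?mul0r ?mul1r //; apply: eq_bigr => v; rewrite !inE => /andP[vr _].
by rewrite child_tips_graft.
Qed.

End ForestSums.

Section TotalCount.
Variables (kappa : seq nat -> rat) (S : nat -> rat).
Hypothesis S_rec : forall d, (0 < d)%N -> S d = (d == 1%N)%:R +
  \sum_(2 <= k < d.+1) \sum_(e in compositions k d)
    kappa (parts e) / k`!%:R * \prod_(i < k) S (e i).

(** The bound on [m] is the total of [2 d - 1] over the roots, the largest size of a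
    forest without unary vertices; the recursion keeps it because a composition
    into [k >= 2] parts lowers [2 d - 1] to [2 d - k], that is by at least one. *)
Lemma forest_count_total m ds :
  all (ltn 0) ds -> (2 * sumn ds <= m + size ds)%N ->
  \sum_(i < m.+1) forest_count kappa i ds = \prod_(d <- ds) S d.
Proof.
elim: m ds => [|m IH] [|d ds] /=.
- by rewrite big_ord1 big_nil.
- move=> /andP[d0 ds0]; have : (size ds <= sumn ds)%N.
    by elim: ds ds0 => //= a ds IHds /andP[a0 /IHds]; lia.
  lia.
- by move=> _ _; rewrite big_nil big_ord_recl /= big1 ?addr0.
move=> /andP[d0 ds0] le_m; rewrite big_ord_recl /= add0r big_cons S_rec //.
rewrite big_split /= mulrDl -mulr_sumr; congr (_ + _).
  by case: (eqVneq d 1%N) => [d1|]; rewrite ?mul0r // IH //; lia.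
rewrite exchange_big mulr_suml; apply: eq_big_nat => k /andP[k2 kd].
rewrite exchange_big mulr_suml; apply: eq_bigr => e eC; rewrite -mulr_sumr -[RHS]mulrA.
have [e0 sumE] := parts_composition eC.
congr (_ * _); rewrite (IH (parts e ++ ds)).
- by rewrite big_cat /= big_map big_enum.
- by rewrite all_cat e0.
- by rewrite sumn_cat size_cat size_parts sumE; lia.
Qed.

End TotalCount.

(** * Isomorphism classes and automorphisms *)
Section Isomorphism.
Variables (V : finType) (p q : {ffun V -> V}) (s : {perm V}).
Hypothesis s_iso : forall v, s (p v) = q (s v).

Lemma fconnect_iso v w : fconnect q (s v) (s w) = fconnect p v w.
Proof.
have itE n : iter n q (s v) = s (iter n p v).
  by elim: n => //= n ->; rewrite s_iso.
apply/idP/idP => /iter_findex.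
  by rewrite itE => /perm_inj <-; apply: fconnect_iter.
by move=> <-; rewrite -itE; apply: fconnect_iter.
Qed.

Lemma is_root_iso v : is_root q (s v) = is_root p v.
Proof. by rewrite /is_root -s_iso (inj_eq perm_inj). Qed.

Lemma children_iso v : children q (s v) = s @: children p v.
Proof.
apply/setP => w; rewrite -[w](permKV s) (mem_imset _ _ perm_inj) !inE -s_iso.
by rewrite !(inj_eq perm_inj).
Qed.

Lemma valency_iso v : valency q (s v) = valency p v.
Proof. by rewrite /valency children_iso (card_imset _ perm_inj) is_root_iso. Qed.

Lemma tips_iso v : tips q (s v) = tips p v.
Proof.
rewrite /tips -[RHS](card_imset _ (@perm_inj _ s)); apply: eq_card => w.
rewrite -[w](permKV s) (mem_imset _ _ perm_inj) !inE fconnect_iso.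
by rewrite /childless -!cards_eq0 children_iso (card_imset _ perm_inj).
Qed.

Lemma child_tips_iso v : perm_eq (child_tips q (s v)) (child_tips p v).
Proof.
have -> : child_tips p v = [seq tips q w | w <- [seq s w | w <- enum (children p v)]].
  by rewrite -map_comp; apply: eq_map => w /=; rewrite tips_iso.
apply: perm_map; apply: uniq_perm; rewrite ?enum_uniq ?(map_inj_uniq perm_inj) ?enum_uniq //.
move=> w; rewrite -[w](permKV s) (mem_map perm_inj) !mem_enum children_iso.
by rewrite (mem_imset _ _ perm_inj).
Qed.

Lemma is_unordered_tree_iso k : is_unordered_tree p k -> is_unordered_tree q k.
Proof.
case/and4P=> /existsP[r /andP[rr /forallP r_conn]] /forallP v1 /forallP v2 /eqP <-.
apply/and4P; split.
- apply/existsP; exists (s r); rewrite is_root_iso rr /=; apply/forallP => v.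
  by rewrite -[v](permKV s) fconnect_iso.
- by apply/forallP => v; rewrite -[v](permKV s) is_root_iso valency_iso.
- by apply/forallP => v; rewrite -[v](permKV s) valency_iso.
- apply/eqP; rewrite -[RHS](card_imset _ (@perm_inj _ s)); apply: eq_card => w.
  rewrite -[w](permKV s) (mem_imset _ _ perm_inj) !inE.
  by rewrite is_root_iso valency_iso.
Qed.

End Isomorphism.

Lemma iso_treeP (V : finType) (p q : {ffun V -> V}) : reflect
  (exists s : {perm V}, forall v, s (p v) = q (s v)) (iso_tree p q).
Proof.
apply: (iffP existsP) => -[s H]; exists s.
  by move=> v; have /forallP/(_ v)/eqP := H.
by apply/forallP => v; rewrite H.
Qed.

Section Orbits.
Variable V : finType.
Implicit Types p q : {ffun V -> V}.

(** Orbit-stabiliser for the action of permutations on parent maps. *)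
Lemma card_iso_class p :
  (#|[set q | iso_tree p q]| * #|Aut_tree p| = #|V|`!)%N.
Proof.
pose relabel (s : {perm V}) : {ffun V -> V} := [ffun v => s (p ((s^-1)%g v))].
have isoE s q : (relabel s == q) = [forall v, s (p v) == q (s v)].
  apply/eqP/forallP => [<- v|H].
    by rewrite ffunE permK.
  by apply/ffunP => v; rewrite ffunE (eqP (H _)) permKV.
have -> : (#|V|`! = \sum_(s : {perm V}) 1)%N.
  rewrite -cardsT -card_perm sum1_card; apply: eq_card => s.
  by rewrite [LHS]inE; apply/subsetP => v; rewrite inE.
rewrite (partition_big relabel (mem [set q | iso_tree p q])) /=; last first.
  move=> s _; rewrite inE; apply/existsP; exists s; rewrite -isoE.
  exact: eqxx.
rewrite -sum_nat_const; apply/esym/eq_bigr => q; rewrite inE => /existsP[t tE].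
rewrite sum1dep_card -[RHS](card_rcoset _ t); apply: eq_card => s.
rewrite mem_rcoset !inE isoE; apply: eq_forallb => v.
by rewrite !permM -[RHS](inj_eq (@perm_inj _ t)) permKV (eqP (forallP tE _)) permKV.
Qed.

End Orbits.

(** The class of [p] has [n! / |Aut p|] members, on all of which [F] has the same
    value. *)
Lemma sum_unordered_trees n k (F : {ffun 'I_n -> 'I_n} -> rat) :
  (forall p q, iso_tree p q -> F p = F q) ->
  \sum_(p in unordered_trees n k) F p / #|Aut_tree p|%:R =
  (\sum_(p | is_unordered_tree p k) F p) / n`!%:R.
Proof.
move=> F_iso; rewrite /unordered_trees.
set D := [set p | _]; set P := equivalence_partition _ _; set X := transversal P D.
have iso_equiv : {in D & &, equivalence_rel (@iso_tree 'I_n)}.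
  by move=> p q r _ _ _; apply: iso_tree_equiv.
have partP : partition P D := equivalence_partitionP iso_equiv.
have trX : is_transversal X P D := transversalP partP.
have isoD p q : iso_tree p q -> p \in D -> q \in D.
  by move=> /iso_treeP[s sE]; rewrite !inE; apply: is_unordered_tree_iso sE _.
have iso_sym p q : iso_tree p q = iso_tree q p.
  have [rf sm] := iso_tree_equiv q p q; have [rf' sm'] := iso_tree_equiv p q p.
  by apply/idP/idP => [/sm' <-|/sm <-].
transitivity (\sum_(p in X) \sum_(q in D | iso_tree q p) F q / n`!%:R); last first.
  rewrite (exchange_big_dep (mem D)) /=; last by move=> p q _ /andP[].
  rewrite mulr_suml; apply: eq_big => q; first by rewrite inE.
  move=> qD; have qP : pblock P q \in P by rewrite pblock_mem // (cover_partition partP).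
  rewrite (big_pred1 (transversal_repr q X (pblock P q))) // => p.
  rewrite /= qD /=; have := setI_transversal_pblock trX q qP.
  move=> /setP/(_ p); rewrite !inE => <-.
  case: (boolP (p \in X)) => // pX.
  have pD := subsetP (transversal_sub trX) p pX.
  by rewrite /= (pblock_equivalence_partition iso_equiv).
apply: eq_bigr => p pX; have pD := subsetP (transversal_sub trX) p pX.
rewrite (eq_bigr (fun=> F p / n`!%:R)); last first.
  by move=> q /andP[_ /F_iso ->].
rewrite sumr_const -[RHS]mulr_natl.
have -> : #|[pred q in D | iso_tree q p]| = #|[set q | iso_tree p q]|.
  apply: eq_card => q; rewrite !inE iso_sym; case: (boolP (iso_tree p q)) => pq; rewrite ?andbF //.
  by have := isoD _ _ pq pD; rewrite inE andbT.
have := card_iso_class p; rewrite card_ord => <-.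
rewrite natrM invfM [RHS]mulrCA; congr (_ * _); rewrite mulVKf // pnatr_eq0.
rewrite -lt0n; apply/card_gt0P; exists p; rewrite inE; apply/iso_treeP.
by exists 1%g => v; rewrite !perm1.
Qed.

Lemma unordered_trees_sub n k (p : {ffun 'I_n -> 'I_n}) :
  p \in unordered_trees n k -> is_unordered_tree p k.
Proof.
set D := [set p : {ffun 'I_n -> 'I_n} | is_unordered_tree p k].
have partP : partition (equivalence_partition (@iso_tree 'I_n) D) D.
  by apply: equivalence_partitionP => x y z _ _ _; apply: iso_tree_equiv.
by move/(subsetP (transversal_sub (transversalP partP))); rewrite inE.
Qed.

(** * Rooted trees as forests with one root *)
Section TreesAsForests.
Variables (V : finType) (p : {ffun V -> V}).

Lemma acyclic_rooted : is_rooted_tree p -> acyclic p.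
Proof.
move=> /existsP[r /andP[/eqP pr /forallP r_conn]].
apply/acyclicP => v w vw wv; have [->//|vDw] := eqVneq v w.
set m := (findex p w v + findex p v w)%N.
have m_iter : iter m p v = v by rewrite iterD !iter_findex.
have m0 : (0 < m)%N.
  rewrite lt0n; apply: contra_neq vDw => m0.
  by move: (iter_findex vw); have -> : findex p v w = 0%N by lia.
(* Going round the cycle often enough passes the root. *)
have vr : v = r.
  have <- : iter (findex p v r * m) p v = v by rewrite iterM iter_fix.
  have le_m : (findex p v r <= findex p v r * m)%N by rewrite leq_pmulr.
  by rewrite -(subnK le_m) iterD iter_findex ?r_conn // iter_fix.
by rewrite vr in vw *; rewrite (fconnect_fixed pr vw).
Qed.

Section OneRoot.
Variable r : V.
Hypotheses (p_forest : forest p [set: V] [:: r]) (r_unary : #|children p r| = 1%N).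

Lemma is_root_forest v : is_root p v = (v == r).
Proof. by rewrite /is_root; have /forestP[_ _ _ -> _] := p_forest; rewrite !inE. Qed.

Lemma valency_forest v : valency p v = (#|children p v| + (v != r))%N.
Proof. by rewrite /valency is_root_forest. Qed.

Lemma leaves_childless : leaves p = [set w | childless p w].
Proof.
apply/setP => w; rewrite !inE is_root_forest valency_forest /childless -cards_eq0.
have [->|_] := eqVneq w r; first by rewrite r_unary.
by rewrite /= addn1.
Qed.

Lemma leaf_number_tips v : leaf_number p v = tips p v.
Proof.
by rewrite /leaf_number leaves_childless; apply: eq_card => w; rewrite !inE.
Qed.

Lemma fconnect_root v : fconnect p v r.
Proof.
have /forestP[ac _ _ fx _] := p_forest; have [w vw pw] := acyclic_fixed v ac.
by move: (fx w); rewrite pw eqxx !inE => /esym/eqP <-.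
Qed.

Lemma card_leaves_tips : #|leaves p| = tips p r.
Proof.
rewrite leaves_childless; apply: eq_card => w; rewrite !inE.
by rewrite fconnect_root andbT.
Qed.

Lemma is_unordered_tree_forest k : is_unordered_tree p k =
  (tips p r == k) && [forall v, (v != r) ==> (#|children p v| != 1%N)].
Proof.
rewrite /is_unordered_tree card_leaves_tips.
have -> : is_rooted_tree p.
  by apply/existsP; exists r; rewrite is_root_forest eqxx; apply/forallP; apply: fconnect_root.
have -> : [forall v, is_root p v ==> (valency p v == 1%N)].
  apply/forallP => v; rewrite is_root_forest; apply/implyP => /eqP ->.
  by rewrite valency_forest r_unary eqxx.
rewrite /= andbC; congr (_ && _); apply: eq_forallb => v; rewrite valency_forest.
by have [->|_] := eqVneq v r; rewrite ?r_unary //= addn1.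
Qed.

End OneRoot.

Lemma unordered_tree_root k : is_unordered_tree p k ->
  exists2 r, forest p [set: V] [:: r] & #|children p r| = 1%N.
Proof.
case/and4P=> rooted /forallP v1 _ _; have ac := acyclic_rooted rooted.
case/existsP: rooted => r /andP[rr /forallP r_conn].
have rootE v : is_root p v = (v == r).
  apply/idP/eqP => [/eqP pv|->//].
  exact/esym/(fconnect_fixed pv).
exists r; last first.
  have /implyP/(_ rr) := v1 r; rewrite /valency rr addn0 => /eqP //.
by apply/forestP; split=> // v; rewrite -?/(is_root p v) ?rootE !inE.
Qed.

End TreesAsForests.

Section TreeWeights.
Variable kappa : seq nat -> rat.
Hypothesis kappa_perm : forall s t, perm_eq s t -> kappa s = kappa t.
Hypothesis kappa0 : kappa [::] = 1.
Hypothesis kappa1 : forall m, kappa [:: m] = 0.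

Definition tree_weight (V : finType) (p : {ffun V -> V}) : rat :=
  \prod_(v | ~~ is_root p v) kappa (child_tips p v).

Lemma tree_weight_iso (V : finType) (p q : {ffun V -> V}) :
  iso_tree p q -> tree_weight p = tree_weight q.
Proof.
move=> /iso_treeP[s sE]; rewrite /tree_weight [RHS](reindex_inj (@perm_inj _ s)) /=.
apply: eq_big => v; first by rewrite (is_root_iso sE).
by move=> _; apply: kappa_perm; rewrite perm_sym (child_tips_iso sE).
Qed.

(** Planted parent maps in which a vertex other than the root is unary are not trees,
    but they have weight 0. *)
Lemma sum_tree_weight (V : finType) d :
  \sum_(p : {ffun V -> V} | is_unordered_tree p d) tree_weight p =
  \sum_(r : V) #|V|.-1`!%:R * forest_count kappa #|V|.-1 [:: d].
Proof.
rewrite -(sum_planted_trees kappa_perm kappa0 kappa1).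
rewrite (exchange_big_dep predT) //= big_mkcond /=; apply: eq_bigr => p _.
have weightE r : forest p [set: V] [:: r] ->
    forest_weight kappa p ([set: V] :\ r) = tree_weight p.
  by move=> fp; apply: eq_bigl => v; rewrite (is_root_forest fp) !inE andbT.
case: ifP => [tp|ntp].
  have [r fp ch1] := unordered_tree_root tp.
  move: tp; rewrite (is_unordered_tree_forest fp ch1) => /andP[tr _].
  rewrite (big_pred1 r) ?weightE // => r'.
  apply/idP/eqP => [/and3P[fp' _ _]|->]; last by rewrite fp ch1 tr.
  by apply/eqP; rewrite -(is_root_forest fp) (is_root_forest fp').
rewrite big1 // => r /and3P[fp /eqP ch1 tr].
move: ntp; rewrite (is_unordered_tree_forest fp ch1) tr /= => /negbT.
rewrite negb_forall => /existsP[v]; rewrite negb_imply negbK => /andP[vr /eqP chv].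
rewrite /forest_weight (bigD1 v) ?inE ?vr //= /child_tips.
have : size [seq tips p w | w <- enum (children p v)] = 1%N by rewrite size_map -cardE.
by case: (map _ _) => [|x []] // _; rewrite kappa1 mul0r.
Qed.

(** A tree with [n] vertices is a forest on [n.-1] vertices planted at one more, so the
    bound [2 d] on [n] is the bound [2 d - 1] under which all forests with one root and
    [d] tips are counted. *)
Lemma sum_trees_over_automorphisms (S : nat -> rat) d :
  (forall d, (0 < d)%N -> S d = (d == 1%N)%:R +
    \sum_(2 <= k < d.+1) \sum_(e in compositions k d)
      kappa (parts e) / k`!%:R * \prod_(i < k) S (e i)) ->
  (0 < d)%N ->
  \sum_(n < (2 * d).+1) \sum_(p in unordered_trees n d)
     tree_weight p / #|Aut_tree p|%:R = S d.
Proof.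
move=> S_rec d0.
rewrite (eq_bigr (fun n : 'I__ =>
  (n != 0%N :> nat)%:R * forest_count kappa n.-1 [:: d])); last first.
  move=> [n n_lt] _ /=; rewrite (sum_unordered_trees _ (@tree_weight_iso _)).
  rewrite sum_tree_weight sumr_const card_ord; case: n {n_lt} => [|n].
    by rewrite mulr0n !mul0r.
  rewrite /= -[X in X / _]mulr_natl mulrA -natrM -factS mulrC mulKf ?mul1r //.
  by rewrite pnatr_eq0 -lt0n fact_gt0.
rewrite big_ord_recl /= mul0r add0r.
under eq_bigr do rewrite mul1r.
have -> : (2 * d = (2 * d).-1.+1)%N by lia.
rewrite (forest_count_total S_rec) ?big_seq1 //= ?d0 //; lia.
Qed.

End TreeWeights.

(** * The weight of a vertex *)
Section VertexWeight.
Variable G : nat -> nat * nat.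

Definition movable_factor (l : nat) : rat :=
  (l`!%:R) ^- 2 * ((pfact (G 1 *+ l))%:R / (pfact (G 1))%:R ^+ l).

Definition lattice_factor (s : seq nat) : rat :=
  (pfact (G (sumn s)))%:R / (pfact (\sum_(m <- s) G m))%:R.

(** A vertex is movable when all its children carry one tip; the value 0 on
    singletons excludes bivalent vertices from the sum over all parent maps. *)
Definition vertex_weight (s : seq nat) : rat :=
  match size s with
  | 0 => 1
  | 1 => 0
  | l => lattice_factor s * (if all (pred1 1%N) s then movable_factor l - 1 else -1)
  end.

Lemma vertex_weight_perm s t : perm_eq s t -> vertex_weight s = vertex_weight t.
Proof.
move=> st; rewrite /vertex_weight /lattice_factor (perm_size st) (perm_all _ st).
by rewrite (perm_big _ st) /= !sumnE (perm_big _ st).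
Qed.

Lemma vertex_weight_ge2 s : (1 < size s)%N -> vertex_weight s =
  lattice_factor s * (if all (pred1 1%N) s then movable_factor (size s) - 1 else -1).
Proof. by rewrite /vertex_weight; case: (size s) => [|[]]. Qed.

(** Movability can be read off the numbers of tips of the children: without unary
    vertices, an internal vertex carries at least two tips. *)
Lemma tree_weightE (V : finType) (p : {ffun V -> V}) k : is_unordered_tree p k ->
  (-1) ^+ #|Vin p :\: Vmov p| *
  (\prod_(v in Vin p) ((pfact (G (leaf_number p v)))%:R /
      (pfact (\sum_(w in children p v) G (leaf_number p w)))%:R)) *
  (\prod_(v in Vmov p) (movable_factor (leaf_number p v) - 1)) =
  tree_weight vertex_weight p.
Proof.
move=> tp; have [r fp ch1] := unordered_tree_root tp.
move: (tp); rewrite (is_unordered_tree_forest fp ch1) => /andP[_ /forallP no_unary].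
have ac : acyclic p by have /forestP[] := fp.
have VinE v : (v \in Vin p) = (v != r) && (1 < #|children p v|)%N.
  rewrite inE (is_root_forest fp) (valency_forest fp).
  have [//|vr] := eqVneq v r; have /implyP/(_ vr) := no_unary v.
  by case: #|children p v| => [|[]].
have rootE v : v != r -> v \notin Vin p -> childless p v.
  move=> vr; rewrite VinE vr /= -leqNgt /childless -cards_eq0.
  by have /implyP/(_ vr) := no_unary v; case: #|children p v| => [|[]].
have child_nonroot v u : u \in children p v -> u != r.
  rewrite inE => /andP[/eqP pu uv]; apply: contra_neq uv => ur.
  by rewrite -pu; apply/esym/eqP; rewrite -/(is_root p u) (is_root_forest fp) ur.
have tips_childless v : childless p v -> tips p v = 1%N.
  by move=> cv; rewrite tips_rec // cv (eqP cv) big_set0.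
have childless_tips v : v != r -> tips p v = 1%N -> childless p v.
  move=> vr tv; apply: rootE => //; rewrite VinE vr /= -leqNgt.
  move: tv; rewrite tips_rec // /childless -cards_eq0.
  case: eqP => [->//|_]; rewrite add0n => <-.
  by rewrite -sum1_card; apply: leq_sum => u _; apply: tips_gt0.
have sum_tips v : v \in Vin p -> sumn (child_tips p v) = tips p v.
  rewrite VinE => /andP[_ ch]; rewrite [RHS]tips_rec // /childless -cards_eq0.
  by rewrite sumnE big_map big_enum /=; case: #|_| ch.
have mov_tips v : v \in Vin p -> (v \in Vmov p) = all (pred1 1%N) (child_tips p v).
  move=> vV; rewrite inE vV /=; apply/forall_inP/allP => [mov x /mapP[u]|one w wV].
    rewrite mem_enum => uv -> /=; apply/eqP/tips_childless.
    apply: rootE; first exact: child_nonroot uv.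
    move: uv; rewrite inE => /andP[/eqP pu]; apply: contraNN => /mov/implyP; apply.
    by rewrite -pu fconnect1.
  apply/implyP => wv; apply/negP => /negP w_v.
  move: (fconnect_children v w ac); rewrite wv (negbTE w_v) big1 // => u uv.
  have u1 : tips p u = 1%N.
    by apply/eqP/one/map_f; rewrite mem_enum.
  have cu := childless_tips u (child_nonroot v u uv) u1.
  rewrite (fconnect_children u w ac) (eqP cu) big_set0 addn0.
  by case: eqP => // wu; move: wV; rewrite wu VinE (eqP cu) cards0 andbF.
have size_mov v : v \in Vmov p -> size (child_tips p v) = tips p v.
  move=> vM; have vV : v \in Vin p by move: vM; rewrite inE => /andP[].
  rewrite -(sum_tips v vV); move: vM; rewrite mov_tips // => /all_pred1P ->.
  by rewrite size_nseq sumn_nseq mul1n.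
rewrite /tree_weight [RHS](bigID (mem (Vin p))) /= [X in _ = _ * X]big1 ?mulr1; last first.
  move=> v /andP[]; rewrite (is_root_forest fp) => vr vV.
  by rewrite /child_tips (eqP (rootE v vr vV)) enum_set0.
rewrite [RHS](eq_bigl (fun v => v \in Vin p)); last first.
  by move=> v /=; rewrite (is_root_forest fp) VinE; case: (v != r).
rewrite [RHS](eq_bigr (fun v => lattice_factor (child_tips p v) *
    (if v \in Vmov p then movable_factor (tips p v) - 1 else -1))); last first.
  move=> v vV; rewrite vertex_weight_ge2; last first.
    by move: vV; rewrite VinE => /andP[_]; rewrite size_map -cardE.
  by rewrite mov_tips //; case: ifP => // vM; rewrite size_mov // mov_tips.
rewrite [RHS]big_split /= mulrAC mulrC; congr (_ * _).
  apply: eq_bigr => v vV; rewrite /lattice_factor sum_tips // (leaf_number_tips fp ch1).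
  rewrite big_map big_enum /=; congr (_ / (pfact _)%:R).
  by apply: eq_bigr => w _; rewrite (leaf_number_tips fp ch1).
rewrite [RHS](big_setID (Vmov p)) /=.
have -> : Vin p :&: Vmov p = Vmov p.
  by apply/setIidPr/subsetP => v; rewrite inE => /andP[].
rewrite mulrC; congr (_ * _).
  by apply: eq_bigr => v vM; rewrite vM (leaf_number_tips fp ch1).
rewrite -prodr_const; apply: eq_bigr => v; rewrite inE => /andP[/negbTE -> _] //.
Qed.

(** The part of the vertex weight that only movable vertices have reproduces the
    inhomogeneous term [(d!)^-3], as the only composition into ones has [d] parts. *)
Lemma vertex_weight_recursion (S : nat -> rat) d : (1 < d)%N -> S 1%N = 1 ->
  \sum_(2 <= k < d.+1) \sum_(e in compositions k d)
    vertex_weight (parts e) / k`!%:R * \prod_(i < k) S (e i) =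
  (pfact (G d))%:R * (d`!%:R ^- 3 / (pfact (G 1))%:R ^+ d -
   \sum_(2 <= k < d.+1) \sum_(e in compositions k d)
     (\prod_(i < k) S (e i)) / (k`!%:R * (pfact (\sum_(i < k) G (e i)))%:R)).
Proof.
move=> d1 S1.
pose ones : rat := lattice_factor (nseq d 1%N) * movable_factor d / d`!%:R.
transitivity (\sum_(2 <= k < d.+1) \sum_(e in compositions k d)
  ((nseq d 1%N == parts e)%:R * ones - (pfact (G d))%:R *
     ((\prod_(i < k) S (e i)) / (k`!%:R * (pfact (\sum_(i < k) G (e i)))%:R)))).
  apply: eq_big_nat => k /andP[k2 _]; apply: eq_bigr => e eC.
  have [_ sumE] := parts_composition eC.
  rewrite vertex_weight_ge2 ?size_parts // !big_parts /lattice_factor sumE.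
  have -> : (if all (pred1 1%N) (parts e) then movable_factor k - 1 else -1) =
      (nseq d 1%N == parts e)%:R * movable_factor k - 1.
    have <- : all (pred1 1%N) (parts e) = (nseq d 1%N == parts e).
      apply/all_pred1P/eqP => [pE|<-]; last by rewrite size_nseq.
      rewrite [RHS]pE; congr nseq; move: sumE.
      by rewrite [in LHS]pE sumn_nseq mul1n size_parts.
    by case: ifP => _; rewrite ?mul1r ?mul0r ?sub0r.
  case: eqP => [pE|_]; last by rewrite !mul0r invfM; ring.
  have kd : k = d by rewrite -(size_parts e) -pE size_nseq.
  rewrite /ones /lattice_factor -pE sumn_nseq mul1n kd.
  have -> : \prod_(m <- nseq d 1%N) S m = 1.
    by rewrite big_nseq S1; elim: (d) => //= n ->; rewrite mul1r.
  rewrite invfM; ring.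
under eq_bigr => k _ do rewrite big_split /= -mulr_suml -natr_sum sumrN -mulr_sumr.
rewrite big_split /= sumrN -mulr_sumr mulrBr; congr (_ - _).
have onesE k : (\sum_(e in compositions k d) (nseq d 1%N == parts e) = (k == d))%N.
  have [->|kd] := eqVneq k d.
    rewrite (@sum_compositions d d) ?size_nseq ?all_nseq ?orbT //.
    by rewrite sumn_nseq mul1n eqxx.
  rewrite big1 // => e _; case: eqP => // /(congr1 size).
  by rewrite size_nseq size_parts => dk; rewrite dk eqxx in kd.
under eq_bigr => k _ do rewrite onesE.
rewrite -mulr_suml (bigD1_seq d) ?iota_uniq ?mem_index_iota ?d1 ?ltnSn //= eqxx.
rewrite big1 ?addr0; last by move=> k /negbTE ->.
rewrite mul1r /ones /lattice_factor /movable_factor sumn_nseq mul1n.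
have -> : \sum_(m <- nseq d 1%N) G m = G 1 *+ d.
  by rewrite big_nseq iter_addr_0.
have n0 : (pfact (G 1 *+ d))%:R != 0 :> rat.
  by rewrite pnatr_eq0 -lt0n muln_gt0 !fact_gt0.
have d0 : d`!%:R != 0 :> rat by rewrite pnatr_eq0 -lt0n fact_gt0.
have g0 : (pfact (G 1))%:R ^+ d != 0 :> rat.
  by rewrite expf_neq0 // pnatr_eq0 -lt0n muln_gt0 !fact_gt0.
by field; rewrite n0 d0 g0.
Qed.

End VertexWeight.

(** * The superpotential *)

(** Rescaling by [(Gamma_2 !)^d] turns the recursion for the superpotential into
    the recursion for the weighted trees. *)
Lemma rescaled_superpotential (R : realType) (T : R -> nat -> rat) (a : R)
    (G := fun m => Gamma a (3 * m - 1))
    (S := fun m => Ttilde T a m / (pfact (Gamma a 2))%:R ^+ m) :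
  superpotential_recursion T -> 0 < a -> forall d, (0 < d)%N ->
  S d = (d == 1%N)%:R + \sum_(2 <= k < d.+1) \sum_(e in compositions k d)
    vertex_weight G (parts e) / k`!%:R * \prod_(i < k) S (e i).
Proof.
move=> hT a0 d d0; set g := (pfact (Gamma a 2))%:R in S *.
have g0 : g != 0 by rewrite pnatr_eq0 -lt0n muln_gt0 !fact_gt0.
have S1 : S 1%N = 1.
  rewrite /S hT // /recursion_rhs big_geq // subr0 -[1`!]/1%N invr1 expr1n mulr1.
  by rewrite -[(3 * 1 - 1)%N]/2%N expr1 divff.
have [->|d1] := eqVneq d 1%N; first by rewrite S1 big_geq ?addr0.
have {d0}d1 : (1 < d)%N by lia.
rewrite add0r vertex_weight_recursion // {1}/S hT //; last by lia.
rewrite /recursion_rhs -mulrA; congr (_ * _); rewrite mulrBl exprVn; congr (_ - _).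
rewrite mulr_suml; apply: eq_bigr => k _; rewrite mulr_suml; apply: eq_bigr => e.
rewrite inE => /andP[_ /eqP ed].
have -> : g ^+ d = \prod_(i < k) g ^+ e i by rewrite prodrXr ed.
by rewrite mulrAC -prodf_div.
Qed.

Theorem theorem1 (R : realType) (T : R -> nat -> rat)
    (hT : superpotential_recursion T)
    (a : R) (d : nat) (ha : 0 < a) (hd : (1 <= d)%N) :
  Ttilde T a d =
    (pfact (Gamma a 2))%:R ^+ d *
    \sum_(n < (2 * d).+1) \sum_(p in unordered_trees n d)
      (-1) ^+ #|Vin p :\: Vmov p| / #|Aut_tree p|%:R *
      (\prod_(v in Vin p)
         ((pfact (Gamma a (3 * leaf_number p v - 1)))%:R /
          (pfact (\sum_(w in children p v)
                    Gamma a (3 * leaf_number p w - 1)))%:R)) *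
      (\prod_(v in Vmov p)
         (((leaf_number p v)`!%:R) ^- 2 *
          ((pfact (Gamma a 2 *+ leaf_number p v))%:R /
           (pfact (Gamma a 2))%:R ^+ leaf_number p v) - 1)).
Proof.
pose G m := Gamma a (3 * m - 1).
have S_rec := rescaled_superpotential hT ha.
have g0 : (pfact (Gamma a 2))%:R ^+ d != 0 :> rat.
  by rewrite expf_neq0 // pnatr_eq0 -lt0n muln_gt0 !fact_gt0.
transitivity ((pfact (Gamma a 2))%:R ^+ d * (\sum_(n < (2 * d).+1)
  \sum_(p in unordered_trees n d) tree_weight (vertex_weight G) p / #|Aut_tree p|%:R)).
  rewrite (sum_trees_over_automorphisms (@vertex_weight_perm G) _ _ S_rec) //.
  by rewrite mulrCA divff // mulr1.
congr (_ * _); apply: eq_bigr => n _; apply: eq_bigr => p /unordered_trees_sub tp.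
by rewrite -(tree_weightE G tp) /movable_factor mulrAC; congr (_ * _); rewrite mulrAC.
Qed.
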